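(* Let $d\ge0$. The natural projection $\mathcal P_d:A\to\mathcal A_d$ extends to a completely bounded map on $\mathcal A$ with completely bounded norm at most $\max(4d,1)$.
   Context: **Reduced free product.** $(A_i,\phi_i)_{i\in I}$ is a family of unital $C^*$-algebras with states $\phi_i$ whose GNS representations are faithful. $H_i=L_2(A_i,\phi_i)$ is the GNS Hilbert space with cyclic vector $\xi_i$, $\hat a=a\xi_i$, $\langle\hat a,\hat b\rangle=\phi_i(a^*b)$; $\mathring H_i=\xi_i^\perp$, $\mathring A_i=\ker\phi_i$. The notation $i_1\ne i_2\ne\cdots\ne i_n$ means consecutive indices are distinct. Let $\mathcal F=\mathbb C\Omega\oplus\bigoplus_{n\ge1,\ i_1\ne\cdots\ne i_n}\mathring H_{i_1}\otimes\cdots\otimes\mathring H_{i_n}$ (Hilbert space sum). $A_i$ acts faithfully and unitally on $\mathcal F$: for $a\in\mathring A_i$, $a\Omega=\hat a$, and for $h_1\otimes\cdots\otimes h_n\in\mathring H_{i_1}\otimes\cdots\otimes\mathring H_{i_n}$, $a\cdot(h_1\otimes\cdots\otimes h_n)=\hat a\otimes h_1\otimes\cdots\otimes h_n$ if $i\ne i_1$, and $=[ah_1-\langle\xi_i,ah_1\rangle\xi_i]\otimes h_2\otimes\cdots\otimes h_n+\langle\xi_i,ah_1\rangle h_2\otimes\cdots\otimes h_n$ if $i=i_1$. The algebraic free product $A=\mathbb C1\oplus\bigoplus_{d\ge1,\ i_1\ne\cdots\ne i_d}\mathring A_{i_1}\otimes\cdots\otimes\mathring A_{i_d}$ is thereby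 embedded in $\mathbb B(\mathcal F)$, $a_1\otimes\cdots\otimes a_d$ acting as the product $a_1\cdots a_d$. The reduced free product $\mathcal A=*_{i\in I}(A_i,\phi_i)$ is the norm closure of $A$ in $\mathbb B(\mathcal F)$. **Homogeneous parts.** $\Sigma_0=\mathbb C1$, $\Sigma_d=\bigoplus_{i_1\ne\cdots\ne i_d}\mathring A_{i_1}\otimes\cdots\otimes\mathring A_{i_d}$ for $d\ge1$, and $\mathcal A_d$ is the norm closure of $\Sigma_d$ in $\mathcal A$ (the closed span of the words of length $d$). $\mathcal P_d:A\to\mathcal A_d$ sends an element of $A=\bigoplus_{k\ge0}\Sigma_k$ to its homogeneous component of degree $d$. *)

(* Defs.v *)
From HB Require Import structures.
From mathcomp Require Import all_boot all_order all_algebra sesquilinear.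
From mathcomp Require Import all_classical all_reals all_analysis.
From mathcomp.real_closed Require Import complex.

Set Implicit Arguments.
Unset Strict Implicit.
Unset Printing Implicit Defensive.

Import Order.TTheory GRing.Theory Num.Theory.
Import numFieldNormedType.Exports.

Local Open Scope classical_set_scope.
Local Open Scope complex_scope.
Local Open Scope ring_scope.

(* Norms of complex normed spaces take their values in R[i]; [rnorm] is the
   same number as an element of R. *)
Definition rnorm (R : realType) (V : normedModType R[i]) (x : V) : R :=
  complex.Re `|x|.

Lemma rnormE (R : realType) (V : normedModType R[i]) (x : V) :
  (rnorm x)%:C = `|x|.
Proof. by rewrite /rnorm RRe_real// normr_real. Qed.

HB.mixin Record isHilbert (R : realType) H & CompleteNormedModule R[i] H := {
  hform : {dot H for Num.conj};
  sqr_normE : forall x : H, `|x| ^+ 2 = hform x x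
}.

#[short(type="hilbertType")]
HB.structure Definition Hilbert (R : realType) :=
  {H of CompleteNormedModule R[i] H & isHilbert R H}.

(* [{dot _ for _}] is linear in its first argument; [<x | y>] is linear in y. *)
Definition inner (R : realType) (H : hilbertType R) (x y : H) : R[i] :=
  (hform : {dot H for Num.conj}) y x.

Notation "[< x | y >]" := (inner x y)
  (at level 0, x at level 39, format "[<  x  |  y  >]") : ring_scope.

(* The library has no join of the algebra and normed module structures, and
   none can be added downstream; hence the explicit norm, with completeness
   as convergence of Cauchy sequences. *)
HB.mixin Record isCStarAlgebra (R : realType) A & GRing.Algebra R[i] A := {
  cnorm : A -> R;
  cnormD : forall a b : A, cnorm (a + b) <= cnorm a + cnorm b;
  cnormZ : forall (c : R[i]) (a : A), cnorm (c *: a) = complex.Re `|c| * cnorm a;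
  cnorm_eq0 : forall a : A, cnorm a = 0 -> a = 0;
  cnormM : forall a b : A, cnorm (a * b) <= cnorm a * cnorm b;
  cnorm_complete : forall u : nat -> A,
    (forall e : R, 0 < e -> exists N, forall m n, (N <= m)%N -> (N <= n)%N ->
       cnorm (u m - u n) < e) ->
    exists l : A, forall e : R, 0 < e -> exists N, forall n, (N <= n)%N ->
      cnorm (u n - l) < e;
  star : A -> A;
  star_antilinear : forall (c : R[i]) (a b : A),
    star (c *: a + b) = c^* *: star a + star b;
  starK : involutive star;
  starM : forall a b : A, star (a * b) = star b * star a;
  cstar_identity : forall a : A, cnorm (star a * a) = cnorm a ^+ 2
}.

#[short(type="cstarAlgType")]
HB.structure Definition CStarAlgebra (R : realType) :=
  {A of GRing.Algebra R[i] A & isCStarAlgebra R A}.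

Record state (R : realType) (A : cstarAlgType R) := State {
  state_fun :> {scalar A};
  state_ge0 : forall a : A, 0 <= state_fun (star a * a);
  state1 : state_fun 1 = 1
}.

Definition bounded_linear (R : realType) (H K : hilbertType R) : {pred H -> K} :=
  [pred f | `[< linear f /\
     exists M : R, forall x, rnorm (f x) <= M * rnorm x >]].

Record bop (R : realType) (H K : hilbertType R) := Bop {
  bop_fun :> H -> K;
  _ : bop_fun \in @bounded_linear R H K
}.

Notation "''B' ( H , K )" := (bop H K) (at level 8, format "''B' ( H ,  K )") : type_scope.

Section BoundedOperators.
Context (R : realType).
Implicit Types H K L : hilbertType R.

Lemma rnorm_ge0 H (x : H) : 0 <= rnorm x.
Proof. by rewrite -lecR rnormE normr_ge0. Qed.

Lemma rnorm0 H : rnorm (0 : H) = 0.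
Proof. by rewrite /rnorm normr0. Qed.

Lemma rnormD H (x y : H) : rnorm (x + y) <= rnorm x + rnorm y.
Proof. by rewrite -lecR rmorphD/= !rnormE ler_normD. Qed.

Lemma rnormZ H (c : R[i]) (x : H) :
  rnorm (c *: x) = complex.Re `|c| * rnorm x.
Proof.
apply: (@complexI R); rewrite rmorphM/= !rnormE normrZ; congr (_ * _).
Qed.

Lemma rnorm0_eq0 H (x : H) : rnorm x = 0 -> x = 0.
Proof. by move=> x0; apply/normr0_eq0; rewrite -rnormE x0. Qed.

Lemma bounded_linear_submod H K : submod_closed (@bounded_linear R H K).
Proof.
split.
  apply: asboolT; split; first by move=> c x y; rewrite /= scaler0 addr0.
  by exists 0 => x; rewrite mul0r rnorm0.
move=> c f g; move=> /asboolW[linf [M fM]] /asboolW[ling [N gN]].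
apply: asboolT; split.
  move=> a x y; rewrite /= !fctE linf ling !scalerDr !scalerA mulrC.
  by rewrite addrACA.
exists (complex.Re `|c| * M + N) => x.
have c0 : 0 <= complex.Re `|c| :> R.
  by rewrite -lecR RRe_real ?normr_real /= ?normr_ge0.
apply: (le_trans (rnormD _ _)); rewrite rnormZ mulrDl -mulrA.
by apply: lerD => //; exact: ler_wpM2l.
Qed.

HB.instance Definition _ H K := [isSub for @bop_fun R H K].
HB.instance Definition _ H K := [Choice of 'B(H, K) by <:].
HB.instance Definition _ H K :=
  GRing.isSubmodClosed.Build R[i] (H -> K) (@bounded_linear R H K)
    (bounded_linear_submod H K).
HB.instance Definition _ H K := [SubChoice_isSubLmodule of 'B(H, K) by <:].

Lemma bop_linear H K (T : 'B(H, K)) : linear T.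
Proof. by have /asboolW[] := valP T. Qed.

HB.instance Definition _ H K (T : 'B(H, K)) :=
  GRing.isLinear.Build R[i] H K _ (bop_fun T) (bop_linear T).

Lemma bop_bounded H K (T : 'B(H, K)) :
  exists M : R, forall x, rnorm (T x) <= M * rnorm x.
Proof. by have /asboolW[] := valP T. Qed.

Lemma bopP H K (S T : 'B(H, K)) : S =1 T -> S = T.
Proof. by move=> /funext ST; apply/val_inj. Qed.

Lemma bop_addE H K (S T : 'B(H, K)) x : (S + T) x = S x + T x.
Proof. by []. Qed.

Lemma bop_scaleE H K (c : R[i]) (T : 'B(H, K)) x : (c *: T) x = c *: T x.
Proof. by []. Qed.

Definition opnorm H K (T : 'B(H, K)) : R :=
  sup [set rnorm (T x) | x in [set x | rnorm x <= 1]].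

Lemma opnorm_has_sup H K (T : 'B(H, K)) :
  has_sup [set rnorm (T x) | x in [set x | rnorm x <= 1]].
Proof.
split; first by exists (rnorm (T 0)); exists 0 => //=; rewrite rnorm0 ler01.
have [M TM] := bop_bounded T; exists `|M| => _ [x /= x1 <-].
apply: (le_trans (TM x)); apply: (@le_trans _ _ (`|M| * rnorm x)).
  by rewrite ler_wpM2r ?rnorm_ge0 ?ler_norm.
by rewrite ler_piMr.
Qed.

Lemma opnorm_ub H K (T : 'B(H, K)) x : rnorm x <= 1 -> rnorm (T x) <= opnorm T.
Proof. by move=> x1; apply: sup_upper_bound; [exact: opnorm_has_sup|exists x]. Qed.

Lemma opnorm_ge0 H K (T : 'B(H, K)) : 0 <= opnorm T.
Proof.
by apply: le_trans (@opnorm_ub _ _ T 0 _); rewrite ?rnorm_ge0 // rnorm0 ler01.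
Qed.

Lemma opnorm_le H K (T : 'B(H, K)) x : rnorm (T x) <= opnorm T * rnorm x.
Proof.
have [->|x0] := eqVneq x 0; first by rewrite linear0 !rnorm0 mulr0.
have nx0 : rnorm x != 0 by apply: contra x0 => /eqP/rnorm0_eq0 ->.
have nx : 0 < rnorm x by rewrite lt_neqAle eq_sym nx0 rnorm_ge0.
have cE : complex.Re `|((rnorm x)^-1)%:C| = (rnorm x)^-1.
  by rewrite ger0_norm// lecR invr_ge0 ltW.
rewrite -ler_pdivrMr// mulrC -[leLHS]/(_ * _) -cE -rnormZ -linearZ.
by apply: opnorm_ub; rewrite rnormZ cE mulVf.
Qed.

Lemma opnorm_leP H K (T : 'B(H, K)) (M : R) :
  0 <= M -> (forall x, rnorm (T x) <= M * rnorm x) -> opnorm T <= M.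
Proof.
move=> M0 TM; apply: ge_sup; first by case: (opnorm_has_sup T).
by move=> _ [x /= x1 <-]; apply: (le_trans (TM x)); rewrite ler_piMr.
Qed.

Lemma opnormD H K (S T : 'B(H, K)) : opnorm (S + T) <= opnorm S + opnorm T.
Proof.
apply: opnorm_leP; first by rewrite addr_ge0 ?opnorm_ge0.
move=> x; rewrite bop_addE mulrDl; apply: (le_trans (rnormD _ _)).
by apply: lerD; exact: opnorm_le.
Qed.

Lemma Re_norm_ge0 (c : R[i]) : 0 <= complex.Re `|c|.
Proof. by rewrite -lecR RRe_real ?normr_real /= ?normr_ge0. Qed.

Lemma opnormZ_le H K (c : R[i]) (T : 'B(H, K)) :
  opnorm (c *: T) <= complex.Re `|c| * opnorm T.
Proof.
apply: opnorm_leP; first by rewrite mulr_ge0 ?opnorm_ge0 ?Re_norm_ge0.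
move=> x; rewrite bop_scaleE rnormZ -mulrA ler_wpM2l ?Re_norm_ge0//.
exact: opnorm_le.
Qed.

Lemma opnormZ H K (c : R[i]) (T : 'B(H, K)) :
  opnorm (c *: T) = complex.Re `|c| * opnorm T.
Proof.
apply/eqP; rewrite eq_le opnormZ_le andTb.
have [->|c0] := eqVneq c 0; first by rewrite normr0 mul0r opnorm_ge0.
rewrite -[in leLHS](scale1r T) -(mulVf c0) -scalerA.
have nc0 : complex.Re `|c| != 0.
  by apply: contra c0 => /eqP c0; rewrite -normr_eq0 -[`|c|]RRe_real ?normr_real// c0.
apply: (le_trans (ler_wpM2l (Re_norm_ge0 c) (opnormZ_le _ _))).
rewrite mulrA [leLHS](_ : _ = opnorm (c *: T))//.
rewrite -[RHS]mul1r; congr (_ * _); apply: (@complexI R).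
rewrite rmorphM rmorph1; transitivity (`|c| * `|c^-1|).
  by congr (_ * _); apply: RRe_real; exact: normr_real.
by rewrite -normrM mulfV// normr1.
Qed.

Lemma opnorm_eq0 H K (T : 'B(H, K)) : opnorm T = 0 -> T = 0.
Proof.
move=> T0; apply: bopP => x; apply: rnorm0_eq0; apply/eqP.
by rewrite eq_le rnorm_ge0 andbT; have := opnorm_le T x; rewrite T0 mul0r.
Qed.

Definition bop_norm H K (T : 'B(H, K)) : R[i] := (opnorm T)%:C.

Lemma bop_normD H K (S T : 'B(H, K)) : bop_norm (S + T) <= bop_norm S + bop_norm T.
Proof. by rewrite -rmorphD lecR opnormD. Qed.

Lemma bop_normZ H K (c : R[i]) (T : 'B(H, K)) :
  bop_norm (c *: T) = `|c| * bop_norm T.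
Proof.
rewrite /bop_norm opnormZ rmorphM; congr (_ * _).
Qed.

Lemma bop_norm_eq0 H K (T : 'B(H, K)) : bop_norm T = 0 -> T = 0.
Proof. by move=> /(@complexI R)/opnorm_eq0. Qed.

HB.instance Definition _ H K := Lmodule_isNormed.Build R[i] 'B(H, K)
  (@bop_normD H K) (@bop_normZ H K) (@bop_norm_eq0 H K).

Lemma bop_closureP H K (S : set 'B(H, K)) (T : 'B(H, K)) :
  closure S T <-> forall e : R, 0 < e -> exists2 U, S U & opnorm (T - U) < e.
Proof.
split=> [ST e e0|ST B /nbhs_ballP[e /= e0 eB]].
  have e0' : 0 < e%:C by rewrite ltcR.
  by have [U [SU]] := ST _ (nbhsx_ballx T _ e0'); rewrite -ball_normE/= ltcR; exists U.
have er : (complex.Re e)%:C = e by apply: RRe_real; exact: gtr0_real.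
have [|U SU TU] := ST (complex.Re e); first by rewrite -ltcR er.
by exists U; split=> //; apply: eB; rewrite -ball_normE/= -er ltcR.
Qed.

Lemma bop_id_subproof H : (idfun : H -> H) \in @bounded_linear R H H.
Proof. by apply: asboolT; split=> //; exists 1 => x; rewrite mul1r. Qed.

Definition bop_id H : 'B(H, H) := Bop (bop_id_subproof H).

Lemma bop_comp_subproof H K L (S : 'B(K, L)) (T : 'B(H, K)) :
  S \o T \in @bounded_linear R H L.
Proof.
apply: asboolT; split; first by move=> c x y; rewrite /= !linearP.
exists (opnorm S * opnorm T) => x; rewrite -mulrA.
apply: (le_trans (opnorm_le S (T x))).
by rewrite ler_wpM2l ?opnorm_ge0 ?opnorm_le.
Qed.

Definition bop_comp H K L (S : 'B(K, L)) (T : 'B(H, K)) : 'B(H, L) :=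
  Bop (bop_comp_subproof S T).

End BoundedOperators.

Definition lspan (K : pzRingType) (V : lmodType K) (S : set V) : set V :=
  [set v | exists n (c : 'I_n -> K) (s : 'I_n -> V),
    (forall k, S (s k)) /\ v = \sum_k c k *: s k].

(* The norm of the operator matrix T on the Hilbert space sum of n copies
   of H. *)
Definition mx_opnorm (R : realType) (H : hilbertType R) n
    (T : 'M['B(H, H)]_n) : \bar R :=
  ereal_sup [set (Num.sqrt (\sum_i rnorm (\sum_j T i j (x j)) ^+ 2))%:E
            | x in [set x : 'I_n -> H | \sum_j rnorm (x j) ^+ 2 <= 1]].

(* The completely bounded norm of E, seen as a map on the operator space S. *)
Definition cb_norm (R : realType) (H K : hilbertType R) (S : set 'B(H, H))
    (E : 'B(H, H) -> 'B(K, K)) : \bar R :=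
  ereal_sup [set r | exists n (T : 'M['B(H, H)]_n),
    [/\ forall i j, S (T i j), (mx_opnorm T <= 1)%E
      & r = mx_opnorm (map_mx E T)]].

Definition linear_on (K : pzRingType) (V W : lmodType K) (S : set V)
    (E : V -> W) :=
  forall (c : K) (u v : V), S u -> S v -> E (c *: u + v) = c *: E u + E v.

(* The Hilbert space L_2(A, phi) is the Hausdorff completion of A; it is given
   here by the GNS triple (space, representation, cyclic vector), which is
   unique up to unitary equivalence. *)
Record gns (R : realType) (A : cstarAlgType R) (phi : state A) := GNS {
  gns_space :> hilbertType R;
  gns_rep : {linear A -> 'B(gns_space, gns_space)};
  gns_vec : gns_space;
  gns_rep1 : gns_rep 1 = bop_id gns_space;
  gns_repM : forall a b, gns_rep (a * b) = bop_comp (gns_rep a) (gns_rep b);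
  gns_rep_star : forall a x y,
    [< gns_rep (star a) x | y >] = [< x | gns_rep a y >];
  gns_cyclic : closure (range (fun a => gns_rep a gns_vec)) = setT;
  gns_vec_state : forall a, phi a = [< gns_vec | gns_rep a gns_vec >]
}.

Definition gns_hat (R : realType) (A : cstarAlgType R) (phi : state A)
  (G : gns phi) (a : A) : G := gns_rep G a (gns_vec G).

(* i_1 <> i_2 <> ... <> i_n for the word (i_1, x_1) ... (i_n, x_n) *)
Definition alternating (I : eqType) (X : I -> Type) (w : seq {i & X i}) : bool :=
  sorted (fun a b => tag a != tag b) w.

Section FreeProduct.
Context (R : realType) (I : eqType) (A : I -> cstarAlgType R)
  (phi : forall i, state (A i)) (G : forall i, gns (phi i)).

(* the words h_1 ... h_n such that h_1 (x) ... (x) h_n is an elementary tensor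
   of one of the summands of the free Fock space *)
Definition fock_word (w : seq {i & G i}) : bool :=
  alternating w && all (fun a => [< gns_vec (G (tag a)) | tagged a >] == 0) w.

Definition letter_inner (a b : {i & G i}) : R[i] :=
  if tag a == tag b then [< tagged a | tagged_as a b >] else 0.

(* Distinct words of indices give orthogonal summands; within a summand the
   inner product of elementary tensors is the product of inner products. *)
Fixpoint word_inner (u v : seq {i & G i}) : R[i] :=
  match u, v with
  | [::], [::] => 1
  | a :: u', b :: v' => letter_inner a b * word_inner u' v'
  | _, _ => 0
  end.

(* The Hilbert space sum of the Hilbert space tensor products: a complete space
   in which the elementary tensors are total and have the prescribed inner
   products. This determines it up to a unique unitary equivalence fixing
   elementary tensors, and it implies multilinearity of [fock_tensor] on
   [fock_word]s. The values of [fock_tensor] on other words are irrelevant. *)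
Record fock := Fock {
  fock_space :> hilbertType R;
  fock_tensor : seq {i & G i} -> fock_space;
  fock_tensor_inner : forall u v, fock_word u -> fock_word v ->
    [< fock_tensor u | fock_tensor v >] = word_inner u v;
  fock_total : closure (lspan (fock_tensor @` fock_word)) = setT
}.

Definition vacuum (F : fock) : F := fock_tensor F [::].

(* The actions of the A i on the Fock space; the formulas determine them. *)
Record free_rep (F : fock) := FreeRep {
  free_act :> forall i, {linear A i -> 'B(F, F)};
  free_act1 : forall i, free_act i 1 = bop_id F;
  free_act_vacuum : forall i (a : A i), phi i a = 0 ->
    free_act i a (vacuum F) = fock_tensor F [:: Tagged G (gns_hat (G i) a)];
  free_act_neq : forall i (a : A i) (h : {j & G j}) w, phi i a = 0 ->
    fock_word (h :: w) -> i != tag h ->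
    free_act i a (fock_tensor F (h :: w)) =
      fock_tensor F (Tagged G (gns_hat (G i) a) :: h :: w);
  free_act_eq : forall i (a : A i) (h : G i) w, phi i a = 0 ->
    fock_word (Tagged G h :: w) ->
    let c := [< gns_vec (G i) | gns_rep (G i) a h >] in
    free_act i a (fock_tensor F (Tagged G h :: w)) =
      fock_tensor F (Tagged G (gns_rep (G i) a h - c *: gns_vec (G i)) :: w)
      + c *: fock_tensor F w
}.

Context (F : fock) (lam : free_rep F).

Definition word_op (w : seq {i & A i}) : 'B(F, F) :=
  foldr (fun a T => bop_comp (lam (tag a) (tagged a)) T) (bop_id F) w.

Definition alg_word (w : seq {i & A i}) : bool :=
  alternating w && all (fun a => phi (tag a) (tagged a) == 0) w.

Definition Sigma (d : nat) : set 'B(F, F) :=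
  lspan (word_op @` [set w | alg_word w /\ size w = d]).

(* [is_component d S T]: T is the component of degree d of the element S of the
   algebraic free product; this is the graph of the projection P_d. *)
Definition is_component (d : nat) (S T : 'B(F, F)) :=
  exists n (x : nat -> 'B(F, F)), [/\ (d < n)%N, forall k, Sigma k (x k),
    S = \sum_(k < n) x k & T = x d].

Definition alg_free_product : set 'B(F, F) :=
  [set S | exists n (x : nat -> 'B(F, F)),
    (forall k, Sigma k (x k)) /\ S = \sum_(k < n) x k].

Definition reduced_free_product : set 'B(F, F) := closure alg_free_product.

Definition homogeneous_part (d : nat) : set 'B(F, F) := closure (Sigma d).

End FreeProduct.

(* Main.v *)
Require Import Defs.
From mathcomp Require Import all_boot all_order all_algebra sesquilinear.
From mathcomp Require Import all_classical all_reals all_analysis.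
From mathcomp Require Import ring lra zify.
From mathcomp.real_closed Require Import complex.

(* Write [a] in the centered part of [A_i] as creation + diagonal + annihilation
   on the Fock space. In a product [a_1 ... a_k] over an alternating word only
   the patterns "creations, annihilations" and "creations, one diagonal letter,
   annihilations" survive, so that the action on a tensor is a sum of terms
   indexed by the position where the word is cut.

   For natural numbers [i], [j], let [Phi_ij T] send a tensor of length [m > j]
   to the result of applying [T] to its first [j] letters, keeping only output of
   length [i] and gluing the untouched letters back (output that cannot be glued
   is dropped); tensors of length [m <= j] are sent to the part of length
   [m - j + i] of their image under [T]. A variant [Phi'_ij] lets [T] act on
   [j + 1] letters and keeps output of length [i + 1] whose last letter has the
   same index as before. In an orthonormal basis of words these maps are block
   diagonal with blocks which are compressions of [T], hence they are complete
   contractions of [B(F)]. On a term with [l] letters annihilated and [c] created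
   (a diagonal letter counts as both), [Phi_ij] is the identity if [c - l = i - j]
   and [l <= j] and is zero otherwise; the same holds for [Phi'_ij] with
   [l <= j + 1] instead if there is a diagonal letter. Counting solutions, as in
   the Haagerup-Moller formula for radial multipliers,
     P_d = sum_(i+j=d) Phi_ij - sum_(i+j=d-1) Phi_ij
           + sum_(i+j=d-1) Phi'_ij - sum_(i+j=d-2) Phi'_ij,
   which has (d + 1) + d + d + (d - 1) = 4d terms (one term if [d = 0]). *)

Set Implicit Arguments.
Unset Strict Implicit.
Unset Printing Implicit Defensive.

Import Order.TTheory GRing.Theory Num.Theory.
Import numFieldNormedType.Exports.

Local Open Scope classical_set_scope.
Local Open Scope ring_scope.

(** * Inner products *)

Section InnerProduct.
Context (R : realType) (H : hilbertType R).
Implicit Types (x y z : H) (c : R[i]).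

Lemma innerDr x y z : [< x | y + z >] = [< x | y >] + [< x | z >].
Proof. exact: linearDl. Qed.

Lemma innerZr c x y : [< x | c *: y >] = c * [< x | y >].
Proof. exact: linearZl_LR. Qed.

Lemma innerC x y : [< x | y >] = Num.conj [< y | x >].
Proof. by rewrite /inner hermC/= expr0 mul1r. Qed.

Lemma innerDl x y z : [< x + y | z >] = [< x | z >] + [< y | z >].
Proof. by rewrite (innerC (x + y)) innerDr rmorphD (innerC x) (innerC y). Qed.

Lemma innerZl c x y : [< c *: x | y >] = Num.conj c * [< x | y >].
Proof. by rewrite (innerC (c *: x)) innerZr rmorphM (innerC x). Qed.

Lemma inner0r x : [< x | 0 >] = 0.
Proof. by rewrite -(scale0r 0) innerZr mul0r. Qed.

Lemma inner0l x : [< 0 | x >] = 0.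
Proof. by rewrite innerC inner0r rmorph0. Qed.

Lemma innerNr x y : [< x | - y >] = - [< x | y >].
Proof. by rewrite -scaleN1r innerZr mulN1r. Qed.

Lemma innerNl x y : [< - x | y >] = - [< x | y >].
Proof. by rewrite -scaleN1r innerZl rmorphN rmorph1 mulN1r. Qed.

Lemma innerBr x y z : [< x | y - z >] = [< x | y >] - [< x | z >].
Proof. by rewrite innerDr innerNr. Qed.

Lemma inner_sumr T (s : seq T) (P : pred T) (f : T -> H) x :
  [< x | \sum_(t <- s | P t) f t >] = \sum_(t <- s | P t) [< x | f t >].
Proof. by apply: (big_morph _ (innerDr x) (inner0r x)). Qed.

Definition sqn x : R := rnorm x ^+ 2.

Lemma sqnE x : (sqn x)%:C%C = [< x | x >].
Proof. by rewrite /sqn rmorphXn/= rnormE sqr_normE. Qed.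

Lemma sqn_ge0 x : 0 <= sqn x. Proof. exact: sqr_ge0. Qed.

Lemma sqn0 : sqn 0 = 0.
Proof. by rewrite /sqn rnorm0 expr0n. Qed.

Lemma sqn_eq0 x : sqn x = 0 -> x = 0.
Proof. by move/eqP; rewrite sqrf_eq0 => /eqP/rnorm0_eq0. Qed.

Lemma inner_eq0_sym x y : [< x | y >] = 0 -> [< y | x >] = 0.
Proof. by move=> xy0; rewrite innerC xy0 rmorph0. Qed.

Lemma sqnD_orth x y : [< x | y >] = 0 -> sqn (x + y) = sqn x + sqn y.
Proof.
move=> xy0; apply: (@complexI R); rewrite rmorphD/= !sqnE innerDl !innerDr.
by rewrite xy0 (inner_eq0_sym xy0) addr0 add0r.
Qed.

Lemma sqnZ c x : sqn (c *: x) = complex.Re `|c| ^+ 2 * sqn x.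
Proof. by rewrite /sqn rnormZ exprMn. Qed.

Lemma rnormN x : rnorm (- x) = rnorm x.
Proof. by rewrite /rnorm normrN. Qed.

Lemma sqnN x : sqn (- x) = sqn x.
Proof. by rewrite /sqn rnormN. Qed.

Lemma rnormB_sym x y : rnorm (x - y) = rnorm (y - x).
Proof. by rewrite -rnormN opprB. Qed.

Lemma rnorm_triangle z x y : rnorm (x - y) <= rnorm (x - z) + rnorm (z - y).
Proof. by have := rnormD (x - z) (z - y); rewrite addrA subrK. Qed.

Lemma parallelogram x y : sqn (x + y) + sqn (x - y) = 2 * (sqn x + sqn y).
Proof.
apply: (@complexI R); rewrite [2 * _]mulrDl !mul1r !rmorphD/= !sqnE.
rewrite !(innerDl, innerDr, innerNl, innerNr).
set a := [< x | x >]; set b := [< y | y >].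
set c := [< x | y >]; set d := [< y | x >].
by ring.
Qed.

Lemma sqn_sum_orth (T : eqType) (s : seq T) (f : T -> H) : uniq s ->
  {in s &, forall u v, u != v -> [< f u | f v >] = 0} ->
  sqn (\sum_(u <- s) f u) = \sum_(u <- s) sqn (f u).
Proof.
elim: s => [|a s IHs]; first by rewrite !big_nil sqn0.
move=> /= /andP[as_ us] fo; rewrite !big_cons sqnD_orth; last first.
  rewrite inner_sumr big_seq big1// => v vs; apply: fo; rewrite ?inE ?eqxx ?vs ?orbT//.
  by apply: contraNneq as_ => ->.
by rewrite IHs// => u v us' vs'; apply: fo; rewrite inE ?us' ?vs' orbT.
Qed.

(** Cauchy-Schwarz by Pythagoras: [d *: x] is the orthogonal projection of [y] onto the line through
    [x], hence no longer than [y]. *)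
Lemma inner_norm_le x y : complex.Re `|[< x | y >]| <= rnorm x * rnorm y.
Proof.
have [->|x0] := eqVneq x 0.
  by rewrite inner0l rnorm0 normr0 mul0r.
have nx0 : 0 < rnorm x.
  rewrite lt_neqAle rnorm_ge0 andbT eq_sym; apply: contra x0 => /eqP/rnorm0_eq0->//.
set c := [< x | y >].
have sx : [< x | x >] != 0.
  by rewrite -sqnE; apply: contra x0 => /eqP/(@complexI R)/sqn_eq0 ->.
pose d := c / [< x | x >].
have o : [< d *: x | y - d *: x >] = 0.
  by rewrite innerZl innerBr innerZr divfK// subrr mulr0.
have := sqnD_orth o; rewrite addrC subrK => yE.
have : sqn (d *: x) <= sqn y by rewrite yE lerDl sqn_ge0.
rewrite sqnZ -exprMn ler_sqr ?nnegrE ?rnorm_ge0 ?mulr_ge0 ?Re_norm_ge0 ?rnorm_ge0//.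
have -> : complex.Re `|d| = complex.Re `|c| / rnorm x ^+ 2.
  apply: (@complexI R); rewrite rmorphM/= fmorphV/=.
  have rr : forall c : R[i], ((complex.Re `|c|)%:C)%C = `|c|.
    by move=> ?; apply: RRe_real; exact: normr_real.
  have g : `|(rnorm x ^+ 2)%:C%C| = (rnorm x ^+ 2)%:C%C :> R[i].
    by apply: ger0_norm; rewrite lecR sqr_ge0.
  by rewrite !rr /d -sqnE /sqn normrM normfV g.
by rewrite expr2 invfM mulrA divfK ?gt_eqF// ler_pdivrMr// mulrC.
Qed.

End InnerProduct.

(** * Closures, completeness and orthogonal projection *)

Lemma ltr_pinv_nat (R : realType) (e : R) : 0 < e -> exists n, n.+1%:R^-1 < e.
Proof.
move=> e0; have ei : 0 <= e^-1 by rewrite invr_ge0 ltW.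
exists (Num.truncn e^-1); rewrite -[ltRHS]invrK ltf_pV2 ?posrE ?invr_gt0//.
by have := real_truncnS_gt (ger0_real ei).
Qed.

Lemma ltr_pinv_natW (R : realType) (e : R) n m :
  n.+1%:R^-1 < e -> (n <= m)%N -> m.+1%:R^-1 < e.
Proof.
move=> ne nm; apply: le_lt_trans ne.
by rewrite lef_pV2 ?posrE// ler_nat.
Qed.

Lemma le_sqr_eps (R : realType) (d r : R) : 0 <= r ->
  (forall e, 0 < e -> d <= (r + e) ^+ 2) -> d <= r ^+ 2.
Proof.
move=> r0 dr; rewrite leNgt; apply/negP => rd.
pose t := d - r ^+ 2; have t0 : 0 < t by rewrite subr_gt0.
(* For this [e], (r + e)^2 - r^2 = e (2 r + e) <= e (2 r + 1) < t, so that (r + e)^2 < d. *)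
pose e := Num.min 1 (t / (2 * r + 2)).
have r2 : 0 < 2 * r + 2 by lra.
have e0 : 0 < e by rewrite lt_min ltr01 divr_gt0.
have e1 : e <= 1 by rewrite ge_min lexx.
have et : e * (2 * r + 2) <= t by rewrite -ler_pdivlMr// ge_min lexx orbT.
by have := dr _ e0; rewrite /t in et t0; nra.
Qed.

Section Topology.
Context (R : realType) (H : hilbertType R).
Implicit Types (x y z : H) (S : set H).

Lemma closure_rnormP S x :
  closure S x <-> forall e : R, 0 < e -> exists2 y, S y & rnorm (x - y) < e.
Proof.
split=> [ST e e0|ST B /nbhs_ballP[e /= e0 eB]].
  have e0' : 0 < e%:C%C by rewrite ltcR.
  have [U [SU]] := ST _ (nbhsx_ballx x _ e0').
  by rewrite -ball_normE/= -rnormE ltcR; exists U.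
have er : ((complex.Re e)%:C)%C = e by apply: RRe_real; exact: gtr0_real.
have [|U SU TU] := ST (complex.Re e); first by rewrite -ltcR er.
by exists U; split=> //; apply: eB; rewrite -ball_normE/= -rnormE -er ltcR.
Qed.

Lemma rnorm_complete (u : nat -> H) :
  (forall e : R, 0 < e -> exists N, forall m n, (N <= m)%N -> (N <= n)%N ->
     rnorm (u m - u n) < e) ->
  exists l, forall e : R, 0 < e -> exists N, forall n, (N <= n)%N ->
    rnorm (l - u n) < e.
Proof.
move=> uc.
have cu : cauchy (u @ \oo).
  apply: cauchy_exP => e e0.
  have er : ((complex.Re e)%:C)%C = e by apply: RRe_real; exact: gtr0_real.
  have [|N uN] := uc (complex.Re e); first by rewrite -ltcR er.
  exists (u N); exists N => // n /= Nn.
  by rewrite -ball_normE/= -rnormE -er ltcR; apply: uN.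
have /cvg_ex[l /cvgrPdist_lt ul] : cvg (u @ \oo) by exact: cauchy_cvg.
exists l => e e0.
have e0' : 0 < e%:C%C by rewrite ltcR.
have [N _ lN] := ul _ e0'; exists N => n Nn.
by rewrite -ltcR rnormE; apply: lN.
Qed.

Lemma closure_limit (S : set H) (u : nat -> H) x :
  (forall n, S (u n)) -> (forall e : R, 0 < e -> exists N, forall n, (N <= n)%N ->
    rnorm (x - u n) < e) -> closure S x.
Proof.
move=> Su ux; apply/closure_rnormP => e e0; have [N uN] := ux _ e0.
by exists (u N) => //; apply: uN.
Qed.

Lemma small_eq0 x : (forall e : R, 0 < e -> rnorm x < e) -> x = 0.
Proof.
move=> xe; apply: rnorm0_eq0; apply/eqP; rewrite eq_le rnorm_ge0 andbT.
by apply/ler_addgt0Pl => e e0; rewrite addr0 ltW// xe.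
Qed.

Lemma closure_orth S x y : (forall z, S z -> [< x | z >] = 0) -> closure S y ->
  [< x | y >] = 0.
Proof.
move=> xS /closure_rnormP Sy; apply/eqP; rewrite -normr_eq0.
rewrite -[`|_|]RRe_real ?normr_real//; apply/eqP; congr (_%:C)%C.
apply/eqP; rewrite eq_le Re_norm_ge0 andbT.
apply/ler_addgt0Pl => e e0; rewrite addr0.
have d0 : 0 < e / (rnorm x + 1) by rewrite divr_gt0// ltr_wpDl// rnorm_ge0.
have [z Sz yz] := Sy _ d0.
have -> : [< x | y >] = [< x | y - z >] by rewrite innerBr (xS z)// subr0.
apply: (le_trans (inner_norm_le _ _)).
apply: (@le_trans _ _ ((rnorm x + 1) * (e / (rnorm x + 1)))).
  by apply: ler_pM; rewrite ?rnorm_ge0// ?lerDl// ltW.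
by rewrite mulrC divfK// gt_eqF// ltr_wpDl// rnorm_ge0.
Qed.

Lemma total_eq0 S x : closure S = setT -> (forall z, S z -> [< x | z >] = 0) ->
  x = 0.
Proof.
move=> ST xS; apply: sqn_eq0; apply: (@complexI R); rewrite sqnE.
by apply: (closure_orth xS); rewrite ST.
Qed.

Lemma closureD S x y : (forall u v, S u -> S v -> S (u + v)) ->
  closure S x -> closure S y -> closure S (x + y).
Proof.
move=> SD /closure_rnormP Sx /closure_rnormP Sy; apply/closure_rnormP => e e0.
have e2 : 0 < e / 2 by lra.
have [u Su xu] := Sx _ e2; have [v Sv yv] := Sy _ e2.
exists (u + v); first exact: SD.
rewrite opprD addrACA; apply: le_lt_trans (rnormD _ _) _; lra.
Qed.

Lemma closureZ S c x : (forall u, S u -> S (c *: u)) ->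
  closure S x -> closure S (c *: x).
Proof.
move=> SZ /closure_rnormP Sx; apply/closure_rnormP => e e0.
have c0 : 0 < complex.Re `|c| + 1 by have := Re_norm_ge0 c; lra.
have e2 : 0 < e / (complex.Re `|c| + 1) by rewrite divr_gt0.
have [u Su xu] := Sx _ e2; exists (c *: u); first exact: SZ.
rewrite -scalerBr rnormZ.
rewrite ltr_pdivlMr// in xu; apply: le_lt_trans xu.
by rewrite mulrC ler_wpM2l ?rnorm_ge0// lerDl.
Qed.

End Topology.

Section Lspan.
Context (K : pzRingType) (V : lmodType K).
Implicit Types S : set V.

Lemma lspan_sub S v : S v -> lspan S v.
Proof.
move=> Sv; exists 1%N, (fun=> 1), (fun=> v); split=> //.
by rewrite big_ord1 scale1r.
Qed.

Lemma lspan0 S : lspan S 0.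
Proof. by exists 0%N, (fun=> 0), (fun=> 0); split; [case|rewrite big_ord0]. Qed.

Lemma lspanZ S c v : lspan S v -> lspan S (c *: v).
Proof.
move=> [n [a [s [Ss ->]]]]; exists n, (fun k => c * a k), s; split=> //.
by rewrite scaler_sumr; apply: eq_bigr => k _; rewrite scalerA.
Qed.

Lemma lspanD S u v : lspan S u -> lspan S v -> lspan S (u + v).
Proof.
move=> [n [a [s [Ss ->]]]] [m [b [t [St ->]]]].
exists (n + m)%N, (fun k => match fintype.split k with inl i => a i | inr j => b j end),
  (fun k => match fintype.split k with inl i => s i | inr j => t j end).
split; first by move=> k; case: (fintype.split k).
rewrite big_split_ord/=; congr (_ + _); apply: eq_bigr => k _.
  by case: split_ordP => j => [/lshift_inj->//|/eqP]; rewrite eq_lrshift.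
by case: split_ordP => j => [/eqP|/rshift_inj->//]; rewrite eq_rlshift.
Qed.

Lemma lspan_sum S (T : Type) (s : seq T) (P : pred T) (f : T -> V) :
  (forall t, P t -> lspan S (f t)) -> lspan S (\sum_(t <- s | P t) f t).
Proof.
by move=> fS; apply: big_ind => //; [exact: lspan0|exact: lspanD].
Qed.

Lemma lspan_min S (D : set V) : (forall v, S v -> D v) -> D 0 ->
  (forall c u v, D u -> D v -> D (c *: u + v)) -> forall v, lspan S v -> D v.
Proof.
move=> SD D0 DD _ [n [c [s [Ss ->]]]].
apply: big_ind => // [u v Du Dv|k _]; first by rewrite -[u]scale1r; apply: DD.
by rewrite -[_ *: _]addr0; apply: DD => //; apply: SD.
Qed.

End Lspan.

Section Projection.
Context (R : realType) (H : hilbertType R).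

(** A minimizing sequence for the distance from [x] to the span of [S] is Cauchy; its limit [y]
    realizes the distance, so that no multiple of an element of [S] can improve it. *)
Lemma lspan_projection (S : set H) (x : H) :
  exists2 y, closure (lspan S) y & forall z, S z -> [< x - y | z >] = 0.
Proof.
pose D := lspan S.
pose A := [set sqn (x - y) | y in D].
have A0 : has_inf A.
  split; first by exists (sqn (x - 0)); exists 0 => //; exact: lspan0.
  by exists 0 => _ [y _ <-]; exact: sqn_ge0.
pose d := inf A.
have dD y : D y -> d <= sqn (x - y).
  by move=> Dy; apply: ge_inf; [case: A0|exists y].
have : forall n, exists y, D y /\ sqn (x - y) < d + n.+1%:R^-1.
  move=> n; have n0 : 0 < n.+1%:R^-1 :> R by rewrite invr_gt0.
  by have [_ [y Dy <-] yd] := inf_adherent n0 A0; exists y.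
move=> /choice[u uP].
(* The midpoint of [u m] and [u n] lies in the span, so its squared distance to [x] is at least [d];
   the parallelogram law then bounds [u m - u n]. *)
have uc m n : sqn (u m - u n) <= 2 * m.+1%:R^-1 + 2 * n.+1%:R^-1.
  have := parallelogram (x - u m) (x - u n).
  have -> : x - u m - (x - u n) = - (u m - u n) by rewrite opprB addrC addrA subrK opprB.
  have -> : x - u m + (x - u n) = (2 : R[i]) *: (x - (2^-1 : R[i]) *: (u m + u n)).
    rewrite scalerBr scalerA mulfV ?pnatr_eq0// scale1r.
    by rewrite -[2]/(1 + 1) scalerDl !scale1r opprD addrACA.
  rewrite sqnN sqnZ.
  have -> : complex.Re `|2 : R[i]| = 2 :> R.
    by rewrite normr_nat.
  have := dD ((2^-1 : R[i]) *: (u m + u n)) _.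
  move=> /(_ (lspanZ _ (lspanD (uP m).1 (uP n).1))).
  have := (uP m).2; have := (uP n).2.
  move: (m.+1%:R^-1 : R) (n.+1%:R^-1 : R) => p q.
  lra.
have [l ul] : exists l, forall e : R, 0 < e -> exists N, forall n, (N <= n)%N ->
    rnorm (l - u n) < e.
  apply: rnorm_complete => e e0.
  have [|N Ne] := @ltr_pinv_nat R (e ^+ 2 / 4).
    by rewrite divr_gt0// exprn_gt0.
  exists N => m n Nm Nn.
  rewrite -(@ltr_pXn2r _ 2)// ?nnegrE ?rnorm_ge0 ?ltW//.
  apply: le_lt_trans (uc m n) _.
  have := ltr_pinv_natW Ne Nm; have := ltr_pinv_natW Ne Nn.
  move: (m.+1%:R^-1 : R) (n.+1%:R^-1 : R) => p q; lra.
have lD : closure D l by apply: (closure_limit _ ul) => n; case: (uP n).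
exists l => // z Sz.
have ineq n c : d <= (rnorm (x - l - c *: z) + rnorm (l - u n)) ^+ 2.
  have Du : D (u n + c *: z) by apply: lspanD; [case: (uP n)|apply: lspanZ; exact: lspan_sub].
  apply: (le_trans (dD _ Du)); rewrite ler_sqr ?nnegrE ?rnorm_ge0 ?addr_ge0 ?rnorm_ge0//.
  rewrite (_ : x - _ = x - l - c *: z + (l - u n)) ?rnormD//.
  by rewrite [RHS]addrAC [x - l + _]addrA subrK opprD addrA.
have dz c : d <= sqn (x - l - c *: z).
  apply: le_sqr_eps => [|e e0]; first exact: rnorm_ge0.
  have [N /(_ N (leqnn N)) lN] := ul _ e0.
  apply: (le_trans (ineq N c)).
  rewrite ler_sqr ?nnegrE ?addr_ge0 ?rnorm_ge0 ?(ltW e0)//.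
  by rewrite lerD2l ltW.
have d0 : 0 <= d.
  by apply: lb_le_inf => [|_ [y _ <-]]; [case: A0|exact: sqn_ge0].
have dl : sqn (x - l) <= d.
  rewrite leNgt; apply/negP => ld; set r := rnorm (x - l).
  have r0 : 0 < r.
    rewrite lt_neqAle rnorm_ge0 andbT eq_sym; apply/eqP => r0.
    by move: ld; rewrite /sqn -/r r0 expr0n /=; lra.
  pose t := sqn (x - l) - d; have t0 : 0 < t by rewrite subr_gt0.
  (* [e <= t / (4 * r)] gives (r - e)^2 > r^2 - t/2 = d + t/2, which exceeds the squared distance
     from [x] to a late [u n]; [e <= r] allows squaring. *)
  pose e := Num.min r (t / (4 * r)).
  have e0 : 0 < e by rewrite lt_min r0 divr_gt0// mulr_gt0.
  have er : e <= r by rewrite ge_min lexx.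
  have et : e * (4 * r) <= t by rewrite -ler_pdivlMr ?mulr_gt0// ge_min lexx orbT.
  have [N1 eN1] := ul _ e0.
  have [|N2 eN2] := @ltr_pinv_nat R (t / 2); first by rewrite divr_gt0.
  pose n := maxn N1 N2.
  have ln := eN1 n (leq_maxl _ _); have tn := ltr_pinv_natW eN2 (leq_maxr N1 N2).
  have : r - e <= rnorm (x - u n).
    have := rnorm_triangle (u n) x l; rewrite (rnormB_sym (u n)) -/r; lra.
  rewrite -ler_sqr ?nnegrE ?rnorm_ge0 ?subr_ge0//.
  have := (uP n).2; move: tn; rewrite /sqn.
  move: (n.+1%:R^-1 : R) (rnorm (x - u n)) => p q.
  move: et t0; rewrite /t -[sqn (x - l)]/(r ^+ 2); nra.
have [z0|z0] := eqVneq z 0; first by rewrite z0 inner0r.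
have sz : [< z | z >] != 0.
  by rewrite -sqnE; apply: contra z0 => /eqP/(@complexI R)/sqn_eq0 ->.
(* Removing the component [c *: z] would lower the squared distance by [sqn (c *: z)], which
   minimality forces to be 0. *)
pose c := [< z | x - l >] / [< z | z >].
have o : [< c *: z | x - l - c *: z >] = 0.
  by rewrite innerZl innerBr innerZr divfK// subrr mulr0.
have := sqnD_orth o; rewrite addrC subrK => wE.
have /eqP : sqn (c *: z) = 0.
  by apply/eqP; rewrite eq_le sqn_ge0 andbT; have := dz c; lra.
move=> /eqP/sqn_eq0/eqP; rewrite scaler_eq0 (negbTE z0) orbF mulf_eq0.
by rewrite invr_eq0 (negbTE sz) orbF => /eqP/inner_eq0_sym.
Qed.
End Projection.

(** * Extending bounded operators from a total family *)

Section Combinations.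
Context (K : pzRingType) (V : lmodType K) (X : eqType).
Implicit Types (f : X -> V) (L : seq (K * X)) (W : pred X).

(** A formal combination is a list of coefficients and indices, repetitions allowed, so that one and
    the same list can be evaluated on two families. *)
Definition comb f L : V := \sum_(p <- L) p.1 *: f p.2.

Definition coef L u : K := \sum_(p <- L | p.2 == u) p.1.

Lemma comb_cat f L1 L2 : comb f (L1 ++ L2) = comb f L1 + comb f L2.
Proof. by rewrite /comb big_cat. Qed.

Lemma comb_scale f c L : comb f [seq (c * p.1, p.2) | p <- L] = c *: comb f L.
Proof.
by rewrite /comb big_map scaler_sumr; apply: eq_bigr => p _; rewrite scalerA.
Qed.

Lemma lspan_comb f W v : lspan (f @` [set u | W u]) v ->
  exists2 L, all (fun p => W p.2) L & v = comb f L.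
Proof.
move: v; apply: lspan_min => [_ [u Wu <-]| |c _ _ [L1 W1 ->] [L2 W2 ->]].
- exists [:: (1, u)]; first by rewrite /= Wu.
  by rewrite /comb big_seq1 scale1r.
- by exists [::] => //; rewrite /comb big_nil.
- exists ([seq (c * p.1, p.2) | p <- L1] ++ L2); last by rewrite comb_cat comb_scale.
  by rewrite all_cat W2 all_map andbT.
Qed.

Lemma comb_coef f L (s : seq X) : uniq s -> {subset [seq p.2 | p <- L] <= s} ->
  comb f L = \sum_(u <- s) coef L u *: f u.
Proof.
move=> us Ls; under eq_bigr do rewrite /coef scaler_suml.
rewrite (exchange_big_dep predT)//= /comb big_seq [RHS]big_seq.
apply: eq_bigr => p pL.
rewrite (eq_bigl (pred1 p.2)) => [|u]; last by rewrite /= eq_sym.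
by rewrite -big_filter filter_pred1_uniq ?big_seq1// Ls// map_f.
Qed.

End Combinations.

Section BopLinear.
Context (R : realType) (H K : hilbertType R) (T : 'B(H, K)).

Lemma bopB x y : T (x - y) = T x - T y. Proof. exact: linearB. Qed.
Lemma bopD x y : T (x + y) = T x + T y. Proof. exact: linearD. Qed.
Lemma bopZ c x : T (c *: x) = c *: T x. Proof. exact: linearZ. Qed.
Lemma bop0 : T 0 = 0. Proof. exact: linear0. Qed.
Lemma bop_sum (I : Type) (s : seq I) (P : pred I) (f : I -> H) :
  T (\sum_(i <- s | P i) f i) = \sum_(i <- s | P i) T (f i).
Proof. exact: (big_morph _ bopD bop0). Qed.

End BopLinear.

Section Extension.
Context (R : realType) (H K : hilbertType R) (X : eqType) (W : pred X).
Context (e : X -> H) (tot : closure (lspan (e @` [set u | W u])) = setT).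
Local Notation C := R[i].

Lemma bop_ext (S T : 'B(H, K)) : (forall u, W u -> S (e u) = T (e u)) -> S = T.
Proof.
move=> ST; apply: bopP => x; apply/eqP; rewrite -subr_eq0; apply/eqP.
have STl : forall v, lspan (e @` [set u | W u]) v -> S v = T v.
  apply: lspan_min => [_ [u Wu <-]| |c y z yE zE]; first exact: ST.
    by rewrite !bop0.
  by rewrite (bop_linear S) (bop_linear T) yE zE.
apply: small_eq0 => r r0.
have M0 : 0 < opnorm S + opnorm T + 1.
  by have := opnorm_ge0 S; have := opnorm_ge0 T; lra.
have : closure (lspan (e @` [set u | W u])) x by rewrite tot.
move=> /closure_rnormP/(_ _ (divr_gt0 r0 M0))[y yl].
rewrite ltr_pdivlMr// => xy.
rewrite (_ : S x - T x = S (x - y) - T (x - y)); last first.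
  by rewrite !bopB (STl y)// opprB addrA subrK.
apply: le_lt_trans xy; apply: (le_trans (rnormD _ _)); rewrite rnormN.
have := opnorm_le S (x - y); have := opnorm_le T (x - y).
have := rnorm_ge0 (x - y); nra.
Qed.

Context (t : X -> K) (M : R) (M0 : 0 <= M).
Hypothesis tM : forall L : seq (C * X), all (fun p => W p.2) L ->
  rnorm (comb t L) <= M * rnorm (comb e L).

(** The closure of the graph of [comb e L] |-> [comb t L]. The bound [tM] makes it single-valued;
    totality and completeness of [K] make it everywhere defined. *)
Let graph x z := forall r : R, 0 < r -> exists L : seq (C * X),
  [/\ all (fun p => W p.2) L, rnorm (x - comb e L) < r & rnorm (z - comb t L) < r].

Let combB (f : X -> H) (g : X -> K) (L L' : seq (C * X)) :
  comb f (L ++ [seq (- 1 * p.1, p.2) | p <- L']) = comb f L - comb f L' /\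
  comb g (L ++ [seq (- 1 * p.1, p.2) | p <- L']) = comb g L - comb g L'.
Proof. by rewrite !comb_cat !comb_scale !scaleN1r. Qed.

Let tMB (L L' : seq (C * X)) : all (fun p => W p.2) L -> all (fun p => W p.2) L' ->
  rnorm (comb t L - comb t L') <= M * rnorm (comb e L - comb e L').
Proof.
move=> WL WL'; have [ <- <- ] := combB e t L L'.
by apply: tM; rewrite all_cat WL all_map.
Qed.

Let graph_exists x : exists z, graph x z.
Proof.
have xl : closure (lspan (e @` [set u | W u])) x by rewrite tot.
have /choice[L LP] : forall n, exists L : seq (C * X), all (fun p => W p.2) L /\
    rnorm (x - comb e L) < n.+1%:R^-1.
  move=> n.
  have n0 : 0 < n.+1%:R^-1 :> R by rewrite invr_gt0.
  have [y /lspan_comb[L WL ->] xy] := (closure_rnormP _ _).1 xl _ n0.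
  by exists L.
have [z zL] : exists z, forall r : R, 0 < r -> exists N, forall n, (N <= n)%N ->
    rnorm (z - comb t (L n)) < r.
  apply: rnorm_complete => r r0.
  have M1 : 0 < 2 * (M + 1) by move: M0; lra.
  have [N Nr] := @ltr_pinv_nat R (r / (2 * (M + 1))) (divr_gt0 r0 M1).
  exists N => m n Nm Nn.
  apply: le_lt_trans (tMB (LP m).1 (LP n).1) _.
  have := rnorm_triangle x (comb e (L m)) (comb e (L n)).
  rewrite (rnormB_sym _ x).
  have := (LP m).2; have := (LP n).2.
  have := ltr_pinv_natW Nr Nm; have := ltr_pinv_natW Nr Nn.
  move: (m.+1%:R^-1 : R) (n.+1%:R^-1 : R) => p q.
  rewrite !ltr_pdivlMr//.
  have := rnorm_ge0 (comb e (L m) - comb e (L n)).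
  move: (rnorm _) (rnorm _) (rnorm _) => a b c; move: M0; nra.
exists z => r r0.
have [N1 N1r] := zL _ r0; have [N2 N2r] := ltr_pinv_nat r0.
exists (L (maxn N1 N2)); split; first by case: (LP (maxn N1 N2)).
  exact: lt_trans (LP _).2 (ltr_pinv_natW N2r (leq_maxr _ _)).
by apply: N1r; exact: leq_maxl.
Qed.

Let graph_bound x z : graph x z -> rnorm z <= M * rnorm x.
Proof.
move=> xz; apply/ler_addgt0Pl => r r0.
have M1 : 0 < 2 * (M + 1) by move: M0; lra.
have [L [WL xL zL]] := xz _ (divr_gt0 r0 M1).
have := rnormD (z - comb t L) (comb t L); rewrite subrK.
have := rnormD (comb e L - x) x; rewrite subrK rnormB_sym.
have := tM WL; move: xL zL; rewrite !ltr_pdivlMr//.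
have := rnorm_ge0 (x - comb e L); have := rnorm_ge0 x; have := rnorm_ge0 (z - comb t L).
move: (rnorm _) (rnorm _) (rnorm _) (rnorm _) (rnorm _) (rnorm _) => *; move: M0; nra.
Qed.

Let graph_lin c x z x' z' : graph x z -> graph x' z' -> graph (c *: x + x') (c *: z + z').
Proof.
move=> xz xz' r r0; have c0 := Re_norm_ge0 c.
have c1 : 0 < 2 * (complex.Re `|c| + 1) by lra.
have r2 : 0 < r / 2 by rewrite divr_gt0.
have [L [WL xL zL]] := xz _ (divr_gt0 r0 c1).
have [L' [WL' xL' zL']] := xz' _ r2.
exists ([seq (c * p.1, p.2) | p <- L] ++ L'); split.
- by rewrite all_cat all_map WL'; rewrite andbT.
- rewrite comb_cat comb_scale opprD addrACA -scalerBr.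
  apply: le_lt_trans (rnormD _ _) _; rewrite rnormZ.
  move: xL xL'; rewrite !ltr_pdivlMr//.
  move: (rnorm_ge0 (x - comb e L)) c0 r0; move: (rnorm _) (rnorm _) (complex.Re _) => *; nra.
- rewrite comb_cat comb_scale opprD addrACA -scalerBr.
  apply: le_lt_trans (rnormD _ _) _; rewrite rnormZ.
  move: zL zL'; rewrite !ltr_pdivlMr//.
  move: (rnorm_ge0 (z - comb t L)) c0 r0; move: (rnorm _) (rnorm _) (complex.Re _) => *; nra.
Qed.

Let graph_uniq x z z' : graph x z -> graph x z' -> z = z'.
Proof.
move=> xz xz'; apply/eqP; rewrite -subr_eq0; apply/eqP/rnorm0_eq0/eqP.
rewrite eq_le rnorm_ge0 andbT.
have := graph_bound (graph_lin (- 1) xz' xz).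
by rewrite !scaleN1r ![- _ + _]addrC subrr rnorm0 mulr0.
Qed.

Lemma bop_extend : exists T : 'B(H, K), forall u, W u -> T (e u) = t u.
Proof.
have /choice[f fP] := graph_exists.
have fb : f \in @bounded_linear R H K.
  apply: asboolT; split; last by exists M => x; exact: graph_bound.
  move=> c x y; apply: graph_uniq (fP _) _; exact: graph_lin.
exists (Bop fb) => u Wu /=; apply: graph_uniq (fP _) _ => r r0.
exists [:: (1, u)]; rewrite /comb !big_seq1/= !scale1r !subrr !rnorm0.
by rewrite Wu.
Qed.

End Extension.

(* [b] bounds the square of the norm of [T] on the sum of [n] copies of [H]. *)
Definition amplified_bound (R : realType) (H K : hilbertType R) n
    (T : 'M['B(H, K)]_n) (b : R) := forall x : 'I_n -> H,
  \sum_i sqn (\sum_j T i j (x j)) <= b * \sum_j sqn (x j).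

Lemma rnorm_sum (R : realType) (H : hilbertType R) (T : Type) (s : seq T) (f : T -> H) :
  rnorm (\sum_(t <- s) f t) <= \sum_(t <- s) rnorm (f t).
Proof.
elim: s => [|t s IHs]; first by rewrite !big_nil rnorm0.
by rewrite !big_cons; apply: le_trans (rnormD _ _) _; rewrite lerD2l.
Qed.

(** * Orthonormal total families *)

Section Orthonormal.
Context (R : realType) (H : hilbertType R) (X : eqType) (W : pred X) (e : X -> H).
Hypothesis eON : forall u v, W u -> W v -> [< e u | e v >] = (u == v)%:R.
Local Notation C := R[i].

Lemma sqn_on u : W u -> sqn (e u) = 1.
Proof. by move=> Wu; apply: (@complexI R); rewrite sqnE eON// eqxx. Qed.

Lemma sqn_on_sum (s : seq X) (P : pred X) (c : X -> C) : uniq s -> all W s ->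
  sqn (\sum_(u <- s | P u) c u *: e u) = \sum_(u <- s | P u) complex.Re `|c u| ^+ 2.
Proof.
move=> us Ws; rewrite -!(big_filter _ P).
have sW u : u \in [seq v <- s | P v] -> W u.
  by rewrite mem_filter => /andP[_] /(allP Ws).
rewrite sqn_sum_orth ?filter_uniq//; last first.
  move=> u v /sW Wu /sW Wv /negPf uv.
  by rewrite innerZl innerZr eON// uv !mulr0.
apply: eq_big_seq => u /sW Wu.
by rewrite sqnZ sqn_on// mulr1.
Qed.

Lemma lspan_common n (x : 'I_n -> H) :
  (forall j, lspan (e @` [set u | W u]) (x j)) ->
  exists s (c : 'I_n -> X -> C),
    [/\ uniq s, all W s & forall j, x j = \sum_(u <- s) c j u *: e u].
Proof.
move=> xl.
have /choice[L LP] : forall j, exists L : seq (C * X),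
    all (fun p => W p.2) L /\ x j = comb e L.
  by move=> j; have [L ? ?] := lspan_comb (xl j); exists L.
pose s := undup (flatten [seq [seq p.2 | p <- L j] | j <- enum 'I_n]).
exists s, (fun j => coef (L j)); split; first exact: undup_uniq.
  apply/allP => u; rewrite mem_undup => /flattenP[_ /mapP[j _ ->]] /mapP[p pL ->].
  exact: (allP (LP j).1).
move=> j; rewrite (LP j).2; apply: comb_coef => [|u uL]; first exact: undup_uniq.
rewrite mem_undup; apply/flattenP; exists [seq p.2 | p <- L j] => //.
by apply: map_f; rewrite mem_enum.
Qed.

Hypothesis tot : closure (lspan (e @` [set u | W u])) = setT.

(** Once equal indices are collected, the norm of a combination of the [e u] is the l^2 norm of its
    coefficients, so only sums over distinct indices have to be estimated. *)
Lemma bop_extend_on (K : hilbertType R) (t : X -> K) (M : R) : 0 <= M ->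
  (forall (s : seq X) (c : X -> C), uniq s -> all W s ->
    sqn (\sum_(u <- s) c u *: t u) <= M ^+ 2 * \sum_(u <- s) complex.Re `|c u| ^+ 2) ->
  exists T : 'B(H, K), forall u, W u -> T (e u) = t u.
Proof.
move=> M0 tM; apply: (bop_extend tot M0) => L WL.
pose s := undup [seq p.2 | p <- L].
have us : uniq s by exact: undup_uniq.
have Ls : {subset [seq p.2 | p <- L] <= s} by move=> u; rewrite mem_undup.
have Ws : all W s by rewrite all_undup all_map.
rewrite !(comb_coef _ us Ls) -ler_sqr ?nnegrE ?mulr_ge0 ?rnorm_ge0//.
rewrite exprMn -!/(sqn _) sqn_on_sum//; exact: tM.
Qed.

Lemma cvg_sum_ord n (f : 'I_n -> nat -> R) (a : 'I_n -> R) :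
  (forall i, f i @ \oo --> a i) -> (fun k => \sum_i f i k) @ \oo --> \sum_i a i.
Proof.
elim: n f a => [|n IHn] f a fa.
  by rewrite big_ord0; under eq_fun do rewrite big_ord0; exact: cvg_cst.
rewrite big_ord_recl; under eq_fun do rewrite big_ord_recl.
by apply: cvgD => //; apply: IHn.
Qed.

Lemma cvg_sqn (K : hilbertType R) (a : K) (b : nat -> K) (B : R) :
  (forall k, rnorm (a - b k) <= B * k.+1%:R^-1) ->
  (fun k => sqn (b k)) @ \oo --> sqn a.
Proof.
move=> ab; suff r : (fun k => rnorm (b k)) @ \oo --> rnorm a by apply: cvgM.
have h : (fun k => B * k.+1%:R^-1) @ \oo --> (0 : R).
  by rewrite -(mulr0 B); apply: cvgM; [exact: cvg_cst|exact: cvg_harmonic].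
apply/subr_cvg0/norm_cvg0P; apply: (squeeze_cvgr _ (cvg_cst 0) h).
near=> k; rewrite normr_ge0/=; apply: le_trans (ab k).
have := rnormD (a - b k) (b k); have := rnormD (b k - a) a.
by rewrite !subrK rnormB_sym; have := rnorm_ge0 (a - b k); case: ler0P; lra.
Unshelve. all: by end_near. Qed.

(** Both sides are continuous in [x]; all entries are approximated simultaneously, up to 1/(k+1). *)
Lemma amplified_bound_dense (K : hilbertType R) n (T : 'M['B(H, K)]_n) (b : R) :
  (forall x : 'I_n -> H, (forall j, lspan (e @` [set u | W u]) (x j)) ->
    \sum_i sqn (\sum_j T i j (x j)) <= b * \sum_j sqn (x j)) ->
  amplified_bound T b.
Proof.
move=> Tb x.
have /choice[y yP] : forall k, exists y : 'I_n -> H,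
    forall j, lspan (e @` [set u | W u]) (y j) /\ rnorm (x j - y j) < k.+1%:R^-1.
  move=> k.
  suff /choice[z zP] : forall j, exists z,
      lspan (e @` [set u | W u]) z /\ rnorm (x j - z) < k.+1%:R^-1 by exists z.
  move=> j.
  have xl : closure (lspan (e @` [set u | W u])) (x j) by rewrite tot.
  have k0 : 0 < k.+1%:R^-1 :> R by rewrite invr_gt0.
  by have [z ? ?] := (closure_rnormP _ _).1 xl _ k0; exists z.
have l : (fun k => \sum_i sqn (\sum_j T i j (y k j))) @ \oo -->
    \sum_i sqn (\sum_j T i j (x j)).
  apply: cvg_sum_ord => i; apply: (@cvg_sqn _ _ _ (\sum_j opnorm (T i j))) => k.
  rewrite -sumrB mulr_suml; apply: le_trans (rnorm_sum _ _) _.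
  apply: ler_sum => j _; rewrite -bopB; apply: (le_trans (opnorm_le _ _)).
  by rewrite ler_wpM2l ?opnorm_ge0// ltW//; case: (yP k j).
have r : (fun k => b * \sum_j sqn (y k j)) @ \oo --> b * \sum_j sqn (x j).
  apply: cvgM; first exact: cvg_cst.
  apply: cvg_sum_ord => j; apply: (@cvg_sqn _ _ _ 1) => k; rewrite mul1r ltW//.
  by case: (yP k j).
apply: ler_cvg_to l r _; near=> k; apply: Tb => j; by case: (yP k j).
Unshelve. all: by end_near. Qed.

End Orthonormal.

(** * Block diagonal complete contractions *)

Lemma bop_closure (R : realType) (H K : hilbertType R) (T : 'B(H, K)) (S : set H) x :
  closure S x -> closure (T @` S) (T x).
Proof.
move=> /closure_rnormP Sx; apply/closure_rnormP => r r0.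
have T1 : 0 < opnorm T + 1 by have := opnorm_ge0 T; lra.
have [y Sy] := Sx _ (divr_gt0 r0 T1); rewrite ltr_pdivlMr// => xy.
exists (T y); first by exists y.
rewrite -bopB; apply: le_lt_trans (opnorm_le _ _) _; apply: le_lt_trans xy.
by rewrite mulrC ler_wpM2l ?rnorm_ge0// lerDl.
Qed.

Section BlockMap.
Context (R : realType) (H : hilbertType R) (X : eqType) (W : pred X) (e : X -> H).
Hypothesis eON : forall u v, W u -> W v -> [< e u | e v >] = (u == v)%:R.
Hypothesis tot : closure (lspan (e @` [set u | W u])) = setT.
(** [Bk] labels the blocks: [f u] gives the block of the input index [u] and its local index, while
    [tau b] says where block [b] puts a local output index, [None] meaning that it is dropped. By
    [tau_inj] distinct blocks have orthogonal outputs. *)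
Context (Bk : eqType) (tau : Bk -> X -> option X) (f : X -> Bk * X).
Hypothesis tauW : forall b w u, W w -> tau b w = Some u -> W u.
Hypothesis tau_inj : forall b b' w w' u, tau b w = Some u -> tau b' w' = Some u ->
  (b, w) = (b', w').
Hypothesis fW : forall u, W u -> W (f u).2.
Hypothesis f_inj : injective f.
Local Notation C := R[i].

Let shifted b w := oapp e 0 (tau b w).

Let shifted_orth b b' w w' : W w -> W w' -> (b, w) != (b', w') ->
  [< shifted b w | shifted b' w' >] = 0.
Proof.
rewrite /shifted => Ww Ww' bw; case E: (tau b w) => [u|] /=; last by rewrite inner0l.
case E': (tau b' w') => [u'|] /=; last by rewrite inner0r.
rewrite eON ?(tauW Ww E) ?(tauW Ww' E')//; case: eqP => // uu'; subst u'.
by rewrite (tau_inj E E') eqxx in bw.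
Qed.

Let sqn_shifted b w : W w -> sqn (shifted b w) <= 1.
Proof.
rewrite /shifted => Ww; case E: (tau b w) => [u|] /=; last by rewrite sqn0.
by rewrite (sqn_on eON) ?(tauW Ww E).
Qed.

Let shifted_bound b (s : seq X) (c : X -> C) : uniq s -> all W s ->
  sqn (\sum_(u <- s) c u *: shifted b u) <= \sum_(u <- s) complex.Re `|c u| ^+ 2.
Proof.
move=> us Ws; rewrite sqn_sum_orth//; last first.
  move=> u v /(allP Ws) Wu /(allP Ws) Wv uv.
  by rewrite innerZl innerZr shifted_orth ?mulr0// xpair_eqE negb_and uv orbT.
rewrite big_seq [leRHS]big_seq; apply: ler_sum => u /(allP Ws) Wu.
by rewrite sqnZ ler_piMr ?sqr_ge0 ?sqn_shifted.
Qed.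

Lemma block_shift : exists U : Bk -> 'B(H, H), forall b w, W w -> U b (e w) = shifted b w.
Proof.
suff /choice[U UP] : forall b, exists T : 'B(H, H), forall w, W w -> T (e w) = shifted b w.
  by exists U.
move=> b; apply: (bop_extend_on eON tot (M := 1)) => // s c us Ws.
by rewrite expr1n mul1r shifted_bound.
Qed.

Context (U : Bk -> 'B(H, H)).
Hypothesis UE : forall b w, W w -> U b (e w) = oapp e 0 (tau b w).

Let Ue_orth b b' x y : b != b' -> [< U b x | U b' y >] = 0.
Proof.
move=> bb'.
have Wx z : closure (lspan (e @` [set u | W u])) z by rewrite tot.
have UW w y' : W w -> [< U b (e w) | U b' y' >] = 0.
  move=> Ww; apply: (closure_orth _ (bop_closure (T := U b') (Wx y'))) => _ [z + <-].
  move: z; apply: lspan_min => [_ [w' Ww' <-]||c z z' z0 z'0].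
  - by rewrite !UE// shifted_orth// xpair_eqE (negbTE bb').
  - by rewrite bop0 inner0r.
  - by rewrite bop_linear innerDr innerZr z0 z'0 mulr0 addr0.
apply: inner_eq0_sym; apply: (closure_orth _ (bop_closure (T := U b) (Wx x))) => _ [z + <-].
move: z; apply: lspan_min => [_ [w Ww <-]||c z z' z0 z'0].
- by apply: inner_eq0_sym; exact: UW.
- by rewrite bop0 inner0r.
- by rewrite bop_linear innerDr innerZr z0 z'0 mulr0 addr0.
Qed.

Let sqn_U b x : sqn (U b x) <= sqn x.
Proof.
have := @amplified_bound_dense _ _ _ _ _ tot _ 1%N (\matrix_(i, j) U b) 1 _ (fun=> x).
rewrite !big_ord1 mxE mul1r; apply=> y yl.
have [s [c [us Ws yE]]] := lspan_common yl.
rewrite !big_ord1 mxE mul1r yE bop_sum (sqn_on_sum eON)//.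
apply: le_trans (shifted_bound b (c ord0) us Ws); rewrite le_eqVlt; apply/orP; left.
apply/eqP; congr sqn; apply: eq_big_seq => u /(allP Ws) Wu.
by rewrite bopZ UE.
Qed.

(** The input is grouped by blocks into vectors [x b j]. Outputs of distinct blocks are orthogonal
    and each [U b] is a contraction, so [T] may be estimated block by block; as [f] is injective,
    the squared norms of the [x b j] add up to those of the input. *)
Lemma block_bound n (T : 'M['B(H, H)]_n) (c : R) (s : seq X) (a : 'I_n -> X -> C) :
  amplified_bound T c -> uniq s -> all W s ->
  \sum_i sqn (\sum_j \sum_(u <- s) a j u *: U (f u).1 (T i j (e (f u).2))) <=
  c * \sum_j \sum_(u <- s) complex.Re `|a j u| ^+ 2.
Proof.
move=> Tc us Ws.
pose bs := undup [seq (f u).1 | u <- s].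
have ubs : uniq bs by exact: undup_uniq.
have regroup (V : nmodType) (g : X -> V) :
    \sum_(u <- s) g u = \sum_(b <- bs) \sum_(u <- s | (f u).1 == b) g u.
  rewrite (exchange_big_dep predT)//= big_seq [RHS]big_seq; apply: eq_bigr => u us'.
  rewrite (eq_bigl (pred1 (f u).1)) => [|b]; last by rewrite /= eq_sym.
  rewrite -big_filter filter_pred1_uniq ?big_seq1// mem_undup.
  exact: (map_f (fun u => (f u).1)).
pose x b j := \sum_(u <- s | (f u).1 == b) a j u *: e (f u).2.
have E i : \sum_j \sum_(u <- s) a j u *: U (f u).1 (T i j (e (f u).2)) =
    \sum_(b <- bs) U b (\sum_j T i j (x b j)).
  under eq_bigr => j _ do rewrite regroup.
  rewrite exchange_big/=; apply: eq_bigr => b _; rewrite bop_sum.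
  apply: eq_bigr => j _; rewrite /x !bop_sum; apply: eq_bigr => u /eqP <-.
  by rewrite !bopZ.
under eq_bigr => i _ do rewrite E.
have xE b j : sqn (x b j) = \sum_(u <- s | (f u).1 == b) complex.Re `|a j u| ^+ 2.
  rewrite /x -!(big_filter s).
  rewrite sqn_sum_orth ?filter_uniq//; last first.
    move=> u v; rewrite !mem_filter => /andP[/eqP ub us'] /andP[/eqP vb vs] uv.
    rewrite innerZl innerZr eON ?fW ?(allP Ws)//.
    case: eqP => [fuv|_]; last by rewrite !mulr0.
    suff uv' : u = v by rewrite uv' eqxx in uv.
    by apply: f_inj; rewrite [f u]surjective_pairing [f v]surjective_pairing ub vb fuv.
  apply: eq_big_seq => u.
  rewrite mem_filter => /andP[_ /(allP Ws) Wu].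
  by rewrite sqnZ (sqn_on eON) ?fW// mulr1.
apply: (@le_trans _ _ (\sum_i \sum_(b <- bs) sqn (\sum_j T i j (x b j)))).
  apply: ler_sum => i _; rewrite sqn_sum_orth//; last first.
    by move=> b b' _ _; exact: Ue_orth.
  by apply: ler_sum => b _; exact: sqn_U.
rewrite exchange_big/= [X in c * X](_ : _ = \sum_(b <- bs) \sum_j sqn (x b j)).
  by rewrite mulr_sumr; apply: ler_sum => b _; exact: Tc.
rewrite [RHS]exchange_big/=; apply: eq_bigr => j _.
by rewrite regroup; apply: eq_bigr => b _; rewrite xE.
Qed.

Lemma amplified_bound_opnorm (T : 'B(H, H)) (n := 1%N) :
  amplified_bound (\matrix_(i < n, j < n) T) (opnorm T ^+ 2).
Proof.
move=> x; rewrite !big_ord1 mxE /sqn -exprMn.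
by rewrite ler_sqr ?nnegrE ?mulr_ge0 ?opnorm_ge0 ?rnorm_ge0// opnorm_le.
Qed.

(** Formally [Phi a] is the sum over the blocks [b] of [U b] times [a] times the adjoint of V_b,
    where V_b sends [e w] to [e u] if [f u = (b, w)], and to 0 if there is no such [u]. The block
    estimate for matrices makes it a complete contraction. *)
Lemma block_map : exists Phi : 'B(H, H) -> 'B(H, H),
  (forall a u, W u -> Phi a (e u) = U (f u).1 (a (e (f u).2))) /\
  (forall n (T : 'M['B(H, H)]_n) c, amplified_bound T c -> amplified_bound (map_mx Phi T) c).
Proof.
have /choice[Phi PhiE] : forall a : 'B(H, H), exists T : 'B(H, H),
    forall u, W u -> T (e u) = U (f u).1 (a (e (f u).2)).
  move=> a; apply: (bop_extend_on eON tot (opnorm_ge0 a)) => s c us Ws.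
  have := block_bound (fun=> c) (amplified_bound_opnorm a) us Ws.
  by rewrite !big_ord1; under eq_bigr do rewrite mxE.
exists Phi; split=> // n T c Tc.
apply: (amplified_bound_dense tot) => x xl.
have [s [a [us Ws xE]]] := lspan_common xl.
have -> : \sum_i sqn (\sum_j map_mx Phi T i j (x j)) =
    \sum_i sqn (\sum_j \sum_(u <- s) a j u *: U (f u).1 (T i j (e (f u).2))).
  apply: eq_bigr => i _; congr sqn; apply: eq_bigr => j _.
  rewrite mxE xE bop_sum big_seq [RHS]big_seq; apply: eq_bigr => u /(allP Ws) Wu.
  by rewrite bopZ PhiE.
apply: le_trans (block_bound _ Tc us Ws) _.
rewrite le_eqVlt; apply/orP; left; apply/eqP; congr (_ * _); apply: eq_bigr => j _.
by rewrite xE (sqn_on_sum eON).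
Qed.

End BlockMap.

(** * Orthonormal words in the free Fock space *)

(** Used to get an orthonormal basis of the complement of the cyclic vector. Zorn's lemma gives a
    maximal [B]; for [y] outside its closed span, the normalized component of [y] orthogonal to [B]
    would enlarge it. *)
Lemma maximal_orthonormal (R : realType) (H : hilbertType R) (x : H) :
  exists B : set H,
    [/\ forall u, B u -> [< x | u >] = 0,
        forall u v, B u -> B v -> [< u | v >] = (u == v)%:R
      & forall y, [< x | y >] = 0 -> closure (lspan B) y].
Proof.
pose P := [set B : set H | (forall u, B u -> [< x | u >] = 0) /\
  (forall u v, B u -> B v -> [< u | v >] = (u == v)%:R)].
have [|B [[Bx BON] Bmax]] := @Zorn_bigcup _ P.
  move=> C CP Ctot; split=> [u [B /CP[+ _]]|u v [B1 CB1 B1u] [B2 CB2 B2v]]; first exact.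
  have [_ O1] := CP _ CB1; have [_ O2] := CP _ CB2.
  by have [/(_ _ B1u)|/(_ _ B2v)] := Ctot _ _ CB1 CB2 => ?; [exact: O2|exact: O1].
exists B; split=> // y xy.
have [p pB yp] := lspan_projection B y.
suff : y - p = 0 by move/eqP; rewrite subr_eq0 => /eqP->.
apply/eqP; apply: contrapT => /negP yp0.
have n0 : rnorm (y - p) != 0 by apply: contra yp0 => /eqP/rnorm0_eq0->.
pose z := ((rnorm (y - p))^-1)%:C%C *: (y - p).
have zB u : B u -> [< z | u >] = 0 by move=> Bu; rewrite innerZl yp// mulr0.
have xp : [< x | p >] = 0.
  apply: closure_orth pB => u; move: u; apply: lspan_min => [//||c u v xu xv].
    by rewrite inner0r.
  by rewrite innerDr innerZr xu xv mulr0 addr0.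
have xz : [< x | z >] = 0 by rewrite innerZr innerBr xy xp subrr mulr0.
have zz : [< z | z >] = 1.
  have cE : complex.Re `|((rnorm (y - p))^-1)%:C%C| = (rnorm (y - p))^-1 :> R.
    by rewrite ger0_norm// lecR invr_ge0 rnorm_ge0.
  by rewrite -sqnE sqnZ cE /sqn exprVn mulVf ?expf_neq0.
have nBz : ~ B z by move=> /zB; rewrite zz => /eqP; rewrite oner_eq0.
case: (Bmax (z |` B)).
  split; first by move=> u Bu; right.
  by move=> /(_ z (or_introl erefl)).
split=> [u [->//|/Bx//]|u v [->|Bu] [->|Bv]].
- by rewrite zz eqxx.
- by rewrite zB//; case: eqP => // zv; case: nBz; rewrite zv.
- by rewrite inner_eq0_sym ?zB//; case: eqP => // uz; case: nBz; rewrite -uz.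
- exact: BON.
Qed.

Section FockWords.
Context (R : realType) (I : eqType) (A : I -> cstarAlgType R)
  (phi : forall i, state (A i)) (G : forall i, gns (phi i)) (F : fock G).
Local Notation letter := {i & G i}.
Local Notation t := (fock_tensor F).
Implicit Types u v w : seq letter.

Definition alt (s : seq I) : bool := sorted (fun i j => i != j) s.

Lemma alternatingE (X : I -> Type) (w : seq {i & X i}) :
  Defs.alternating w = alt [seq tag a | a <- w].
Proof. by rewrite /alt sorted_map. Qed.

Definition centered (a : letter) := [< gns_vec (G (tag a)) | tagged a >] == 0.

Lemma fock_wordE w : fock_word w = alt [seq tag a | a <- w] && all centered w.
Proof. by rewrite /fock_word alternatingE. Qed.

Lemma fock_word_replace i (h h' : G i) u v :
  fock_word (u ++ Tagged G h :: v) -> [< gns_vec (G i) | h' >] = 0 ->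
  fock_word (u ++ Tagged G h' :: v).
Proof.
rewrite !fock_wordE !map_cat/= !all_cat/= => /andP[-> /and3P[-> _ ->]] h0.
by rewrite /centered/= h0 eqxx.
Qed.

Lemma letter_inner_linear (a : letter) i c (h h' : G i) :
  letter_inner a (Tagged G (c *: h + h')) =
  c * letter_inner a (Tagged G h) + letter_inner a (Tagged G h').
Proof.
case: a => j x; rewrite /letter_inner/=; case: eqP => [ji|_]; last by rewrite mulr0 addr0.
by subst j; rewrite !tagged_asE innerDr innerZr.
Qed.

Lemma word_inner_linear w u v i c (h h' : G i) :
  word_inner w (u ++ Tagged G (c *: h + h') :: v) =
  c * word_inner w (u ++ Tagged G h :: v) + word_inner w (u ++ Tagged G h' :: v).
Proof.
elim: u w => [|b u IHu] [|a w] /=; rewrite ?mulr0 ?addr0//.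
  by rewrite letter_inner_linear mulrDl mulrA.
by rewrite IHu mulrDr mulrCA.
Qed.

Lemma word_inner_cat u u' v v' : size u = size u' ->
  word_inner (u ++ v) (u' ++ v') = word_inner u u' * word_inner v v'.
Proof.
elim: u u' => [|a u IHu] [|a' u']//=; first by rewrite mul1r.
by move=> [uu']; rewrite IHu// mulrA.
Qed.

Lemma word_inner_size u v : size u != size v -> word_inner u v = 0.
Proof. by elim: u v => [|a u IHu] [|b v]//= uv; rewrite IHu ?mulr0. Qed.

Lemma letter_inner_tag (a b : letter) : tag a != tag b -> letter_inner a b = 0.
Proof. by rewrite /letter_inner => /negbTE->. Qed.

Lemma word_inner_tags u v : [seq tag a | a <- u] != [seq tag a | a <- v] ->
  word_inner u v = 0.
Proof.
elim: u v => [|a u IHu] [|b v]//=; rewrite eqseq_cons negb_and.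
by case/orP => [/letter_inner_tag->|/IHu->]; rewrite ?mul0r ?mulr0.
Qed.

Lemma letter_inner_self (a : letter) : letter_inner a a = ((sqn (tagged a))%:C)%C.
Proof. by case: a => i x; rewrite /letter_inner/= eqxx tagged_asE sqnE. Qed.

Lemma fock_eq (x y : F) : (forall w, fock_word w -> [< t w | x >] = [< t w | y >]) ->
  x = y.
Proof.
move=> xy; apply/eqP; rewrite -subr_eq0; apply/eqP.
apply: (total_eq0 (fock_total F)) => z; move: z.
apply: lspan_min => [_ [w Ww <-]||c y' z yE zE].
- by apply: inner_eq0_sym; rewrite innerBr xy// subrr.
- by rewrite inner0r.
- by rewrite innerDr innerZr yE zE mulr0 addr0.
Qed.

(** Both sides have the same inner products with the total family of tensors, [word_inner] being
    linear in each letter of its second argument. *)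
Lemma fock_tensor_linear u v i c (h h' : G i) :
  fock_word (u ++ Tagged G h :: v) -> fock_word (u ++ Tagged G h' :: v) ->
  t (u ++ Tagged G (c *: h + h') :: v) =
  c *: t (u ++ Tagged G h :: v) + t (u ++ Tagged G h' :: v).
Proof.
move=> Wh Wh'; have W : fock_word (u ++ Tagged G (c *: h + h') :: v).
  apply: (fock_word_replace Wh); rewrite innerDr innerZr.
  move: Wh Wh'; rewrite !fock_wordE !all_cat/=.
  move=> /andP[_ /and3P[_ /eqP/= h0 _]] /andP[_ /and3P[_ /eqP/= h0' _]].
  by rewrite h0 h0' mulr0 addr0.
apply: fock_eq => w Ww; rewrite innerDr innerZr !fock_tensor_inner//.
exact: word_inner_linear.
Qed.

Lemma fock_tensor_bound u v : exists C : R, forall i (h : G i),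
  fock_word (u ++ Tagged G h :: v) -> rnorm (t (u ++ Tagged G h :: v)) <= C * rnorm h.
Proof.
pose C := complex.Re (word_inner u u * word_inner v v).
exists (Num.sqrt `|C|) => i h W.
rewrite -ler_sqr ?nnegrE ?mulr_ge0 ?sqrtr_ge0 ?rnorm_ge0// exprMn sqr_sqrtr//.
apply: (@le_trans _ _ (C * sqn h)); last by rewrite ler_wpM2r ?sqn_ge0// ler_norm.
rewrite le_eqVlt; apply/orP; left; apply/eqP.
rewrite -/(sqn _) /C -[LHS]/(complex.Re (sqn _)%:C%C) sqnE fock_tensor_inner//.
rewrite word_inner_cat//= letter_inner_self/= mulrCA [RHS]mulrC.
by case: (word_inner u u * _) => a b /=; rewrite mul0r subr0.
Qed.

Context (B : forall i, set (G i)).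
Arguments B i : clear implicits.
Hypothesis B0 : forall i x, B i x -> [< gns_vec (G i) | x >] = 0.
Hypothesis BON : forall i x y, B i x -> B i y -> [< x | y >] = (x == y)%:R.
Hypothesis Btot : forall i y, [< gns_vec (G i) | y >] = 0 -> closure (lspan (B i)) y.

Definition bletter (a : letter) := `[< B (tag a) (tagged a) >].
Definition bword w := alt [seq tag a | a <- w] && all bletter w.

Lemma bword_fock w : bword w -> fock_word w.
Proof.
rewrite fock_wordE => /andP[-> /allP aw]; apply/allP => a /aw /asboolP/B0.
by rewrite /centered => ->.
Qed.

Lemma word_inner_bletter u v : all bletter u -> all bletter v ->
  word_inner u v = (u == v)%:R.
Proof.
elim: u v => [|a u IHu] [|b v]//= /andP[/asboolP au uu] /andP[/asboolP bv vv].
rewrite IHu// eqseq_cons -[in RHS]mulnb natrM; congr (_ * _).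
case: a au => i x; case: b bv => j y /= By Bx.
rewrite /letter_inner/=; case: eqP => [ij|ij].
  subst j; rewrite tagged_asE BON//=; congr (_ %:R); congr nat_of_bool.
  by rewrite -tag_eqE /tag_eq/= eqxx tagged_asE.
by case: eqP => // -[]/ij.
Qed.

Lemma bword_ON u v : bword u -> bword v -> [< t u | t v >] = (u == v)%:R.
Proof.
move=> Bu Bv; rewrite fock_tensor_inner ?bword_fock//.
by case/andP: Bu => _ ?; case/andP: Bv => _ ?; exact: word_inner_bletter.
Qed.

(** Letters are replaced one at a time, from the left, by combinations of basis letters: in the
    induction [u] consists of basis letters already and [v] is arbitrary. *)
Lemma bword_total : closure (lspan (t @` [set w | bword w])) = setT.
Proof.
set M := closure _.
have MD : forall c x y, M x -> M y -> M (c *: x + y).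
  move=> c x y Mx My; apply: closureD => //; first exact: lspanD.
  by apply: closureZ => // z; exact: lspanZ.
have M0 : M 0 by apply: subset_closure; exact: lspan0.
have clM x : closure M x -> M x.
  have cM : closed M by exact: closed_closure.
  by rewrite -((closure_id M).1 cM).
suff Mt : forall w, fock_word w -> M (t w).
  apply/seteqP; split=> // x _; apply: clM.
  have : closure (lspan (t @` (fun w => fock_word w))) x by rewrite fock_total.
  move=> /closure_rnormP xF; apply/closure_rnormP => e /xF[y yF xy]; exists y => //.
  by move: y yF {xy}; apply: lspan_min => // _ [w Ww <-]; exact: Mt.
suff Mt : forall v u, all bletter u -> fock_word (u ++ v) -> M (t (u ++ v)).
  by move=> w Ww; exact: (Mt w [::]).
elim=> [|[i h] v IHv] u Bu W.
  rewrite cats0 in W *; apply: subset_closure; apply: lspan_sub; exists u => //=.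
  by move: W; rewrite fock_wordE /bword Bu => /andP[->].
have Bt b : B i b -> M (t (u ++ Tagged G b :: v)).
  move=> Bb; rewrite -cat_rcons; apply: IHv.
    by rewrite all_rcons Bu andbT; exact/asboolP.
  rewrite cat_rcons; apply: (fock_word_replace W); exact: B0.
have h0 : [< gns_vec (G i) | h >] = 0.
  by move: W; rewrite fock_wordE all_cat => /and4P[_ _ /eqP ->].
have [C tC] := fock_tensor_bound u v.
apply: clM; apply/closure_rnormP => e e0.
have C1 : 0 < `|C| + 1 by rewrite ltr_wpDl.
have /closure_rnormP/(_ _ (divr_gt0 e0 C1))[k kB hk] := Btot h0.
have [k0 Mk] : [< gns_vec (G i) | k >] = 0 /\ M (t (u ++ Tagged G k :: v)).
  move: k kB {hk}; apply: lspan_min => [b Bb||c x y [x0 Mx] [y0 My]].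
  - by split; [exact: B0|exact: Bt].
  - split; first by rewrite inner0r.
    have W0 : fock_word (u ++ Tagged G (0 : G i) :: v).
      by apply: (fock_word_replace W); rewrite inner0r.
    (* Linearity with coefficient -1 shows that a tensor with a zero letter vanishes. *)
    have := fock_tensor_linear (- 1) W0 W0.
    by rewrite scaler0 addr0 scaleN1r addNr => ->.
  - split; first by rewrite innerDr innerZr x0 y0 mulr0 addr0.
    by rewrite fock_tensor_linear ?(fock_word_replace W)//; exact: MD.
exists (t (u ++ Tagged G k :: v)) => //.
have Wk := fock_word_replace W k0.
have := fock_tensor_linear (- 1) Wk W; rewrite !scaleN1r [RHS]addrC => <-.
rewrite addrC; apply: le_lt_trans (tC _ _ _) _.
  by apply: (fock_word_replace W); rewrite innerBr h0 k0 subrr.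
rewrite ltr_pdivlMr// in hk; apply: le_lt_trans hk; rewrite mulrC.
by rewrite ler_wpM2l ?rnorm_ge0// (le_trans (ler_norm C))// lerDl.
Qed.

End FockWords.

(** * The action of an alternating word on a tensor *)

Definition last_opt (T : Type) (s : seq T) : option T :=
  if s is x :: s' then Some (last x s') else None.

Lemma last_opt_rcons (T : Type) (s : seq T) x : last_opt (rcons s x) = Some x.
Proof. by case: s => //= y s; rewrite last_rcons. Qed.

Lemma last_opt_cat (T : Type) (s s' : seq T) :
  last_opt (s ++ s') = if s' is [::] then last_opt s else last_opt s'.
Proof.
by case/lastP: s' => [|s' x]; rewrite ?cats0// -rcons_cat !last_opt_rcons; case: s'. Qed.

Section WordAction.
Context (R : realType) (I : eqType) (A : I -> cstarAlgType R)
  (phi : forall i, state (A i)) (G : forall i, gns (phi i)) (F : fock G).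
Context (lam : free_rep F).
Local Notation letter := {i & G i}.
Local Notation aletter := {i & A i}.
Local Notation t := (fock_tensor F).
Implicit Types (u v : seq letter) (w : seq aletter) (a : aletter) (b : letter).

(** Since [fock_tensor] is arbitrary outside the [fock_word]s, it is cut off to 0 there; a creation
    next to a letter of the same index then vanishes. *)
Definition alt_tensor u : F := if fock_word u then t u else 0.

Definition hat a : letter := Tagged G (gns_hat (G (tag a)) (tagged a)).

(* Meaningful only if [tag a = tag b]: otherwise [tagged_as] returns [hat a]. *)
Definition moved a b : G (tag a) := gns_rep (G (tag a)) (tagged a) (tagged_as (hat a) b).

(** When the indices agree, [moved a b] is the centered vector in [diag a b] plus this multiple of
    the cyclic vector: the diagonal and the annihilation part of [a]. *)
Definition contraction a b : R[i] :=
  if tag a == tag b then [< gns_vec (G (tag a)) | moved a b >] else 0.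

Definition diag a b : letter :=
  Tagged G (moved a b - [< gns_vec (G (tag a)) | moved a b >] *: gns_vec (G (tag a))).

(* [w] acts from its right end, so that its last letter meets the first letter
   of [u]. *)
Fixpoint annih_coef w u : R[i] :=
  if w is a :: w' then
    if drop (size w') u is b :: _ then annih_coef w' u * contraction a b else 0
  else 1.

(** All letters of [w2] annihilate and all those of [w1] create. In [diag_term] the first letter of
    [w2] acts diagonally instead, so that [size w2] is still the number of letters of [u] that are
    acted on. *)
Definition annih_term w1 w2 u : F :=
  annih_coef w2 u *: alt_tensor (map hat w1 ++ drop (size w2) u).

Definition diag_term w1 w2 u : F :=
  if w2 is a :: w2' then
    if drop (size w2') u is b :: z then
      if tag a == tag b then annih_coef w2' u *: alt_tensor (map hat w1 ++ diag a b :: z)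
      else 0
    else 0
  else 0.

Arguments annih_term : simpl never.
Arguments diag_term : simpl never.

Lemma alt_suffix (T : eqType) (s s' : seq T) : alt (s ++ s') -> alt s'.
Proof. by move=> /cat_sorted2[]. Qed.

Lemma alt_prefix (T : eqType) (s s' : seq T) : alt (s ++ s') -> alt s.
Proof. by move=> /cat_sorted2[]. Qed.

Lemma fock_word_suffix u v : fock_word (u ++ v) -> fock_word v.
Proof.
by rewrite !fock_wordE map_cat all_cat => /andP[/alt_suffix-> /andP[_ ->]].
Qed.

Lemma fock_word_prefix u v : fock_word (u ++ v) -> fock_word u.
Proof.
by rewrite !fock_wordE map_cat all_cat => /andP[/alt_prefix-> /andP[->]].
Qed.

Lemma alg_wordE w : alg_word phi w =
  alt [seq tag a | a <- w] && all (fun a => phi (tag a) (tagged a) == 0) w.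
Proof. by rewrite /alg_word alternatingE. Qed.

Lemma alg_word_suffix w w' : alg_word phi (w ++ w') -> alg_word phi w'.
Proof.
by rewrite !alg_wordE map_cat all_cat => /andP[/alt_suffix-> /andP[_ ->]].
Qed.

Lemma centered_hat a : phi (tag a) (tagged a) = 0 -> centered (hat a).
Proof. by rewrite /centered /= -gns_vec_state => ->. Qed.

Lemma gns_vec_norm i : [< gns_vec (G i) | gns_vec (G i) >] = 1.
Proof. by have := gns_vec_state (G i) 1; rewrite gns_rep1 state1 => <-. Qed.

Lemma centered_diag a b : centered (diag a b).
Proof.
by rewrite /centered/= innerBr innerZr gns_vec_norm mulr1 subrr.
Qed.

Lemma act_create a b u : phi (tag a) (tagged a) = 0 -> tag a != tag b ->
  lam (tag a) (tagged a) (alt_tensor (b :: u)) = alt_tensor (hat a :: b :: u).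
Proof.
move=> a0 ab; rewrite /alt_tensor; case: ifPn => [W|nW].
  rewrite free_act_neq//; case: ifPn => // /negP[].
  by move: W; rewrite !fock_wordE /= ab centered_hat.
rewrite bop0; case: ifPn => // W; move: nW.
by rewrite (@fock_word_suffix [:: hat a]).
Qed.

(** If the next letter of [u] has the index of [a], the creation term is 0 because its word fails to
    alternate; otherwise the contraction and the diagonal term are 0. *)
Lemma act_full_annih a w u : phi (tag a) (tagged a) = 0 -> fock_word u ->
  lam (tag a) (tagged a) (annih_term [::] w u) =
  annih_term [:: a] w u + annih_term [::] (a :: w) u + diag_term [::] (a :: w) u.
Proof.
move=> a0 Wu; rewrite /annih_term /diag_term /= bopZ.
have : fock_word (drop (size w) u).
  by apply: (@fock_word_suffix (take (size w) u)); rewrite cat_take_drop.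
rewrite (_ : drop (size w).+1 u = behead (drop (size w) u)); last first.
  by rewrite -drop1 drop_drop add1n.
case: (drop (size w) u) => [|b z] W /=.
  rewrite scale0r !addr0 {1}/alt_tensor W free_act_vacuum//.
  by rewrite /alt_tensor ifT// fock_wordE/= centered_hat.
rewrite /contraction; case: ifPn => ab; last first.
  by rewrite mulr0 scale0r !addr0 act_create.
case: a a0 ab => i a /= a0; case: b W => j h W /= /eqP ij; subst j.
rewrite {1 3}/alt_tensor W (@fock_word_suffix [:: Tagged G h]) // free_act_eq//.
rewrite {1}/alt_tensor ifF; last by rewrite fock_wordE/= eqxx.
rewrite scaler0 add0r /alt_tensor ifT; last first.
  by apply: (@fock_word_replace _ _ _ _ _ _ h _ [::]) => //; apply/eqP; exact: centered_diag.
rewrite /diag /moved /= tagged_asE scalerDr addrC scalerA; congr (_ *: _ + _).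
Qed.

Lemma act_annih_term a c w1 w2 u : phi (tag a) (tagged a) = 0 -> tag a != tag c ->
  lam (tag a) (tagged a) (annih_term (c :: w1) w2 u) = annih_term (a :: c :: w1) w2 u.
Proof. by move=> a0 ac; rewrite /annih_term bopZ /= act_create. Qed.

(** Created or diagonal, the first letter of the output has the index of [c], so [a] can only
    create. This is why no other patterns survive. *)
Lemma act_diag_term a c w1 w2 w u : phi (tag a) (tagged a) = 0 -> tag a != tag c ->
  w1 ++ w2 = c :: w ->
  lam (tag a) (tagged a) (diag_term w1 w2 u) = diag_term (a :: w1) w2 u.
Proof.
move=> a0 ac; rewrite /diag_term; case: w2 => [|e w2]; first by rewrite bop0.
case: (drop _ u) => [|b z]; first by rewrite bop0.
case: ifP => // [eb|]; last by rewrite bop0.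
by case: w1 => [|c' w1] [-> _]; rewrite bopZ /= act_create.
Qed.

(** [r] is the position of the cut. When [a] is put in front, the cut 0 of [w] yields the cuts 0 and
    1 of [a :: w], and every other cut moves by one. *)
Lemma word_op_tensor w u : alg_word phi w -> fock_word u ->
  word_op lam w (t u) =
  \sum_(r < (size w).+1)
    (annih_term (take r w) (drop r w) u + diag_term (take r w) (drop r w) u).
Proof.
elim: w => [|a w IHw] Ww Wu.
  by rewrite big_ord1 /annih_term /diag_term /= drop0 scale1r addr0 /alt_tensor Wu.
have Ww' := @alg_word_suffix [:: a] w Ww.
have a0 : phi (tag a) (tagged a) = 0.
  by move: Ww; rewrite alg_wordE /= => /and3P[_ /eqP].
rewrite /= IHw// bop_sum big_ord_recl [RHS]big_ord_recl /= take0 drop0 bopD.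
rewrite act_full_annih// [X in _ = _ + X]big_ord_recl /= take0 drop0.
have -> : lam (tag a) (tagged a) (diag_term [::] w u) = diag_term [:: a] w u.
  case: w Ww {IHw Ww'} => [|c w] Ww; first by rewrite /diag_term bop0.
  apply: (@act_diag_term _ c _ _ w) => //.
  by move: Ww; rewrite alg_wordE/= => /andP[/andP[]].
rewrite [RHS]addrA; congr (_ + _).
  by rewrite [RHS]addrC -!addrA; congr (_ + _); rewrite addrA addrC.
apply: eq_bigr => r _; rewrite /bump/= !add1n.
case: w Ww {IHw Ww'} r => [|c w] Ww [r rw] //=.
have ac : tag a != tag c by move: Ww; rewrite alg_wordE/= => /andP[/andP[]].
by rewrite bopD act_annih_term// (@act_diag_term _ c _ _ w) //= cat_take_drop.
Qed.

End WordAction.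

(** * Compressions acting on the first letters *)

(** The hypothesis says that [y] is the image of [x] under the adjoint of [T], tested on a total
    set; by continuity it holds everywhere. *)
Lemma inner_ext (R : realType) (H K : hilbertType R) (S : set H) (T : 'B(H, K))
    (x : K) (y : H) : closure (lspan S) = setT ->
  (forall z, S z -> [< x | T z >] = [< y | z >]) ->
  forall z, [< x | T z >] = [< y | z >].
Proof.
move=> tot Sxy z.
have lS : forall v, lspan S v -> [< x | T v >] = [< y | v >].
  apply: lspan_min => [//||c u v uE vE]; first by rewrite bop0 !inner0r.
  by rewrite bop_linear !(innerDr, innerZr) uE vE.
apply/eqP; rewrite -subr_eq0 -normr_eq0 -[`|_|]RRe_real ?normr_real//.
apply/eqP; congr (_%:C)%C; apply/eqP; rewrite eq_le Re_norm_ge0 andbT.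
apply/ler_addgt0Pl => e e0; rewrite addr0.
pose M := rnorm x * opnorm T + rnorm y.
have M0 : 0 <= M by rewrite addr_ge0 ?mulr_ge0 ?rnorm_ge0 ?opnorm_ge0.
have M1 : 0 < M + 1 by lra.
have : closure (lspan S) z by rewrite tot.
move=> /closure_rnormP/(_ _ (divr_gt0 e0 M1))[v vS].
rewrite ltr_pdivlMr// => zv.
have -> : [< x | T z >] - [< y | z >] = [< x | T (z - v) >] - [< y | z - v >].
  by rewrite bopB !innerBr (lS v)// opprB addrA subrK.
apply: (@le_trans _ _ (rnorm x * rnorm (T (z - v)) + rnorm y * rnorm (z - v))).
  apply: (@le_trans _ _ (complex.Re `|[< x | T (z - v) >]| + complex.Re `|[< y | z - v >]|)).
    rewrite -raddfD -lecR !RRe_real ?normr_real// ?realD ?normr_real//.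
    exact: ler_normB.
  by apply: lerD; exact: inner_norm_le.
apply: ltW; apply: le_lt_trans zv.
have := opnorm_le T (z - v); have := rnorm_ge0 x; have := rnorm_ge0 y.
have := rnorm_ge0 (z - v); have := opnorm_ge0 T; rewrite /M; nra.
Qed.

Section Compression.
Context (R : realType) (I : eqType) (A : I -> cstarAlgType R)
  (phi : forall i, state (A i)) (G : forall i, gns (phi i)) (F : fock G).
Context (lam : free_rep F) (B : forall i, set (G i)).
Arguments B i : clear implicits.
Hypothesis B0 : forall i x, B i x -> [< gns_vec (G i) | x >] = 0.
Hypothesis BON : forall i x y, B i x -> B i y -> [< x | y >] = (x == y)%:R.
Hypothesis Btot : forall i y, [< gns_vec (G i) | y >] = 0 -> closure (lspan (B i)) y.
Local Notation letter := {i & G i}.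
Local Notation aletter := {i & A i}.
Local Notation t := (fock_tensor F).
Local Notation tags u := [seq tag a | a <- u].
Implicit Types (u v w s : seq letter).
Context (q : bool) (i j : nat).

(* The maps [Phi_ij] are given by [q = false] and the maps [Phi'_ij] by [q = true].
   A block [(m, s, o)] collects the words of length [m] with untouched part [s];
   if [q] and [m > j], then [o] is the index of the last letter acted on. *)
Definition kept_index (m : nat) (ts : seq I) : option I :=
  if q && (j < m)%N then last_opt ts else None.

Local Notation block := (nat * seq letter * option I)%type.

(** The first test says that the glued word has length m - j + i, stated without subtraction; the
    truncated subtraction in the second makes [s] empty for short words. The three tests together
    allow the block to be read off from the glued word. *)
Definition fits (b : block) (ts : seq I) : bool :=
  [&& size ts + size b.1.2 + j == i + b.1.1, size b.1.2 == b.1.1 - (j + q)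
    & b.2 == kept_index b.1.1 ts]%N.

Definition splitting u : block * seq letter :=
  ((size u, drop (j + q) u, kept_index (size u) (tags (take (j + q) u))), take (j + q) u).

Definition glue (b : block) w : option (seq letter) :=
  if [&& fits b (tags w), alt (tags (w ++ b.1.2)) & all (bletter B) b.1.2]
  then Some (w ++ b.1.2) else None.

Lemma splitting_inj : injective splitting.
Proof. by move=> u v [_ du _ tu]; rewrite -(cat_take_drop (j + q) u) tu du cat_take_drop. Qed.

Lemma splitting_bword u : bword B u -> bword B (splitting u).2.
Proof.
rewrite /= /bword -{1 2}(cat_take_drop (j + q) u) map_cat all_cat.
by move=> /andP[/alt_prefix-> /andP[->]].
Qed.

Lemma glue_bword b w u : bword B w -> glue b w = Some u -> bword B u.
Proof.
rewrite /glue /bword; case: ifP => // /and3P[_ a bs] /andP[_ bw] [ <- ].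
by rewrite a all_cat bw.
Qed.

Lemma glue_inj b b' w w' u : glue b w = Some u -> glue b' w' = Some u ->
  (b, w) = (b', w').
Proof.
case: b => [[m s] o]; case: b' => [[m' s'] o'].
rewrite /glue /fits /=; case: ifP => // /andP[/and3P[/eqP c1 /eqP c2 /eqP ->] _] [ <- ].
case: ifP => // /andP[/and3P[/eqP c1' /eqP c2' /eqP ->] _] [E].
rewrite !size_map in c1 c1'.
have := congr1 size E; rewrite !size_cat => Es.
have mm : m = m' by lia.
subst m'; have ss : size w = size w' by lia.
by move/eqP: E; rewrite eqseq_cat// => /andP[/eqP-> /eqP->].
Qed.

Context (U : block -> 'B(F, F)).
Hypothesis UE : forall b w, bword B w -> U b (t w) = oapp t 0 (glue b w).

(** [U] is prescribed on basis words only, whereas [w] is any word. Both sides are tested against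
    basis words [u'], using that the inner product of glued words is a product. *)
Lemma glue_tensor b w : fock_word w -> all (bletter B) b.1.2 ->
  U b (t w) = if fits b (tags w) then alt_tensor F (w ++ b.1.2) else 0.
Proof.
case: b => [[m s] o] /= Ww Bs.
apply/eqP; rewrite -subr_eq0; apply/eqP.
have tot := bword_total F B0 Btot.
apply: (total_eq0 tot) => z; move: z.
apply: lspan_min => [_ [u' Wu' <-]||c y z yE zE]; last 2 first.
- by rewrite inner0r.
- by rewrite innerDr innerZr yE zE mulr0 addr0.
apply: inner_eq0_sym; rewrite innerBr; apply/eqP; rewrite subr_eq0; apply/eqP.
have Fu' := bword_fock B0 Wu'.
(* The adjoint of [U b] sends [t u'] to [t w0] in the first case and to 0 in the second. *)
have [[w0 [Ww0 g0]]|ng] := pselect (exists w0, bword B w0 /\ glue (m, s, o) w0 = Some u').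
  rewrite (@inner_ext _ _ _ _ _ _ (t w0) tot) => [|_ [v Wv <-]]; last first.
    rewrite UE// (bword_ON F B0 BON)//; case gv : (glue _ v) => [v'|] /=.
      rewrite (bword_ON F B0 BON)// ?(glue_bword Wv gv)//; congr (nat_of_bool _)%:R.
      apply/eqP/eqP => [uv|w0v]; last by move: g0; rewrite w0v gv; case=> ->.
      by subst v'; case: (glue_inj g0 gv).
    rewrite inner0r; case: eqP => // w0v; first by rewrite -w0v g0 in gv.
  rewrite fock_tensor_inner ?(bword_fock B0 Ww0)//.
  move: g0; rewrite /glue/=; case: ifP => // /and3P[fw0 aw0 _] [uE].
  have [E|E] := eqVneq (tags w0) (tags w).
    have Ws : fock_word (w ++ s).
      move: Fu'; rewrite -uE !fock_wordE !map_cat E !all_cat => /andP[-> /andP[_ ->]].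
      by move: Ww; rewrite fock_wordE => /andP[_ ->].
    rewrite -E fw0 /alt_tensor Ws fock_tensor_inner//= -uE word_inner_cat.
      by rewrite (word_inner_bletter BON Bs Bs) eqxx mulr1.
    by have := congr1 size E; rewrite !size_map.
  rewrite word_inner_tags//; case: ifP => fw; last by rewrite inner0r.
  rewrite /alt_tensor; case: ifP => [Ws|]; last by rewrite inner0r.
  rewrite fock_tensor_inner// -uE word_inner_cat; first by rewrite (word_inner_tags E) mul0r.
  move: fw fw0; rewrite /fits/= !size_map => /andP[/eqP c _] /andP[/eqP c' _]; lia.
rewrite (@inner_ext _ _ _ _ _ _ 0 tot) => [|_ [v Wv <-]]; last first.
  rewrite UE// inner0l; case gv : (glue _ v) => [v'|] /=; last by rewrite inner0r.
  rewrite (bword_ON F B0 BON)// ?(glue_bword Wv gv)//; case: eqP => // uv.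
  by case: ng; exists v; rewrite uv.
rewrite inner0l; case: ifP => fw; last by rewrite inner0r.
rewrite /alt_tensor; case: ifP => [Ws|]; last by rewrite inner0r.
rewrite fock_tensor_inner//.
have [su|su] := eqVneq (size u') (size (w ++ s)); last by rewrite word_inner_size.
rewrite -(cat_take_drop (size w) u') word_inner_cat; last first.
  by rewrite size_takel// su size_cat leq_addr.
have Wt : bword B (take (size w) u').
  move: Wu'; rewrite /= /bword -{1 2}(cat_take_drop (size w) u') map_cat all_cat.
  by move=> /andP[/alt_prefix-> /andP[->]].
have Bd : all (bletter B) (drop (size w) u').
  by move: Wu'; rewrite /= /bword -{2}(cat_take_drop (size w) u') all_cat => /and3P[].
rewrite (word_inner_bletter BON Bd Bs); case: eqP => [ds|_]; last by rewrite mulr0.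
have [E|E] := eqVneq (tags (take (size w) u')) (tags w); last first.
  by rewrite word_inner_tags// mul0r.
(* A nonzero inner product would make a prefix of [u'] a preimage of [u'] under gluing. *)
case: ng; exists (take (size w) u'); split=> //.
by rewrite /glue E fw -ds cat_take_drop Bd; case/andP: Wu' => ->.
Qed.

Lemma annih_coef_cat (w : seq aletter) v s : (size w <= size v)%N ->
  annih_coef w (v ++ s) = annih_coef (G := G) w v.
Proof.
elim: w => //= a w IHw wv; rewrite drop_cat wv IHw ?(ltnW wv)//.
case E: (drop _ v) => [|b z] //.
by have := congr1 size E; rewrite size_drop /=; lia.
Qed.

Lemma annih_coef_short (w : seq aletter) v : (size v < size w)%N ->
  annih_coef (G := G) w v = 0.
Proof. by case: w => //= a w; rewrite ltnS => vw; rewrite drop_oversize. Qed.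

Lemma annih_coef_last a (w : seq aletter) v : annih_coef (G := G) (a :: w) v != 0 ->
  size v = (size w).+1 -> last_opt (tags v) = Some (tag a).
Proof.
move=> /= k0 sv; rewrite -(cat_take_drop (size w) v) map_cat last_opt_cat.
case E: (drop (size w) v) k0 => [|b z]; first by rewrite eqxx.
have : size z = 0 by have := congr1 size E; rewrite size_drop sv /=; lia.
move=> /size0nil ->; rewrite /contraction /=; case: (tag a =P tag b) => [ab _|_].
  by rewrite ab.
by rewrite mulr0 eqxx.
Qed.

Lemma alt_tensor_cat0 u v : ~~ fock_word u -> alt_tensor F (u ++ v) = 0.
Proof.
by move=> nu; rewrite /alt_tensor; case: ifP => // /fock_word_prefix; rewrite (negbTE nu). Qed.

Lemma glue_alt_tensor b u : all (bletter B) b.1.2 ->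
  U b (alt_tensor F u) = (fits b (tags u))%:R *: alt_tensor F (u ++ b.1.2).
Proof.
move=> Bs; rewrite {1}/alt_tensor; case: ifPn => Wu; last first.
  by rewrite bop0 alt_tensor_cat0// scaler0.
by rewrite glue_tensor//; case: fits; rewrite ?scale1r ?scale0r.
Qed.

Lemma glue_annih_term (w1 w2 : seq aletter) v s (m := size (v ++ s)) :
  alt [seq tag a | a <- w1 ++ w2] -> all (bletter B) s ->
  (size v <= j + q)%N -> (size s = m - (j + q))%N ->
  U (m, s, kept_index m (tags v)) (annih_term F w1 w2 v) =
  ((size w1 + j == i + size w2) && (size w2 <= j))%N%:R *: annih_term F w1 w2 (v ++ s).
Proof.
rewrite {}/m size_cat => aw Bs vj sm; rewrite /annih_term.
have [vw|wv] := ltnP (size v) (size w2).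
  rewrite (annih_coef_short vw) scale0r bop0; case: leqP => [wj|_]; last first.
    by rewrite andbF scale0r.
  have /size0nil-> : size s = 0%N by lia.
  by rewrite cats0 (annih_coef_short vw) scale0r scaler0.
rewrite annih_coef_cat// bopZ glue_alt_tensor//= -catA.
have -> : drop (size w2) (v ++ s) = drop (size w2) v ++ s.
  rewrite drop_cat ltn_neqAle wv andbT; case: eqP => //= ->.
  by rewrite subnn drop0 drop_oversize.
rewrite !scalerA; congr (_ *: _); rewrite mulrC.
have [->|k0] := eqVneq (annih_coef w2 v) 0; first by rewrite !mulr0.
congr (_%:R * _); congr nat_of_bool.
rewrite /fits /= map_cat !size_cat !size_map size_drop -sm eqxx /=.
have -> : (size w1 + (size v - size w2) + size s + j == i + (size v + size s))%N =
    (size w1 + j == i + size w2)%N by apply/eqP/eqP; lia.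
case: eqP => //= cw.
rewrite {1}/kept_index /kept_index; case: ifP => [/andP[q1 jm]|qj]; last first.
  rewrite eqxx; symmetry; lia.
rewrite last_opt_cat map_drop.
have vj1 : size v = j.+1 by move: vj sm jm; rewrite q1; lia.
case E: (drop (size w2) (tags v)) => [|c z]; last first.
  have -> : last_opt (tags v) = last_opt (c :: z).
    by rewrite -[in LHS](cat_take_drop (size w2) (tags v)) E last_opt_cat.
  rewrite eqxx; have := congr1 size E; rewrite size_drop size_map /=; lia.
have sw : size w2 = j.+1.
  by have := congr1 size E; rewrite size_drop size_map /=; lia.
(* All j + 1 letters are annihilated. The last letter of the output, if there is one, is created by
   the neighbour of [a] in the alternating word, whereas the last letter of [v] has the index of
   [a]; so the index test fails. *)
rewrite sw ltnn; case: w2 sw k0 aw {wv cw E} => //= a w2 [sw] k0 aw.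
rewrite (annih_coef_last k0) ?vj1 ?sw//.
case/lastP: w1 aw => [//|w1 c]; rewrite map_cat !map_rcons cat_rcons /= => aw.
rewrite last_opt_rcons (inj_eq Some_inj) eq_sym.
by move/alt_suffix: aw => /= /andP[/negPf].
Qed.

(** A diagonal letter preserves the index, so the last letter has the same index before and after
    and the index test succeeds. The diagonal letter also counts as created, whence
    [(size w1).+1]. *)
Lemma glue_diag_term (w1 w2 : seq aletter) v s (m := size (v ++ s)) :
  all (bletter B) s -> (size v <= j + q)%N -> (size s = m - (j + q))%N ->
  U (m, s, kept_index m (tags v)) (diag_term F w1 w2 v) =
  (((size w1).+1 + j == i + size w2) && (size w2 <= j + q))%N%:R *: diag_term F w1 w2 (v ++ s).
Proof.
rewrite {}/m size_cat => Bs vj sm; rewrite /diag_term; case: w2 => [|a w2].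
  by rewrite bop0 scaler0.
have [vw|wv] := leqP (size v) (size w2).
  rewrite (drop_oversize vw) bop0 /=; case: (leqP (size w2).+1 (j + q)) => [wj|_]; last first.
    by rewrite andbF scale0r.
  have /size0nil-> : size s = 0%N by lia.
  by rewrite cats0 (drop_oversize vw) scaler0.
rewrite drop_cat wv.
case E: (drop (size w2) v) => [|b z].
  by have := congr1 size E; rewrite size_drop /=; lia.
have zv : size v = ((size w2).+1 + size z)%N.
  by have := congr1 size E; rewrite size_drop /=; lia.
rewrite /=; case: eqP => [ab|_]; last by rewrite bop0 scaler0.
rewrite annih_coef_cat; last by lia.
rewrite bopZ glue_alt_tensor//= -catA /= !scalerA; congr (_ *: _); rewrite mulrC.
congr (_%:R * _); congr nat_of_bool.
rewrite /fits /= map_cat !size_cat /= !size_map -sm eqxx /=.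
have -> : kept_index (size v + size s) (tags (map (hat G) w1) ++ tag a :: tags z) =
    kept_index (size v + size s) (tags v).
  have ov : last_opt (tags v) = last_opt (tags (b :: z)).
    by rewrite -[in LHS](cat_take_drop (size w2) v) E map_cat last_opt_cat.
  by rewrite /kept_index ov last_opt_cat /= ab.
rewrite eqxx andbT; have -> : ((size w2).+1 <= j + q)%N by lia.
by rewrite andbT; apply/eqP/eqP; lia.
Qed.

End Compression.

(** [W] consists of the words in fixed orthonormal bases of the centered parts. The [r] letters
    before the cut create and the [size w - r] letters after it annihilate; a diagonal letter stands
    just after the cut and counts as both. *)
Lemma compression_exists (R : realType) (I : eqType) (A : I -> cstarAlgType R)
    (phi : forall i, state (A i)) (G : forall i, gns (phi i)) (F : fock G)
    (lam : free_rep F) :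
  exists W : pred (seq {i & G i}),
  [/\ closure (lspan (fock_tensor F @` [set u | W u])) = setT,
      {in W, forall u, fock_word u}
    & forall (q : bool) i j, exists Phi : 'B(F, F) -> 'B(F, F),
      [/\ forall n (T : 'M['B(F, F)]_n) c,
            amplified_bound T c -> amplified_bound (map_mx Phi T) c,
          linear Phi
        & forall w u, alg_word phi w -> W u ->
          Phi (word_op lam w) (fock_tensor F u) =
          \sum_(r < (size w).+1)
            ((((r + j == i + (size w - r)) && (size w - r <= j))%N%:R *:
                annih_term F (take r w) (drop r w) u)
             + (((r.+1 + j == i + (size w - r)) && (size w - r <= j + q))%N%:R *:
                diag_term F (take r w) (drop r w) u))]].
Proof.
pose B i := projT1 (cid (maximal_orthonormal (gns_vec (G i)))).
have BP i := projT2 (cid (maximal_orthonormal (gns_vec (G i)))).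
have B0 i x : B i x -> [< gns_vec (G i) | x >] = 0 by case: (BP i) => + _ _; exact.
have BON i x y : B i x -> B i y -> [< x | y >] = (x == y)%:R.
  by case: (BP i) => _ + _; exact.
have Btot i y : [< gns_vec (G i) | y >] = 0 -> closure (lspan (B i)) y.
  by case: (BP i) => _ _; exact.
have ON := bword_ON F B0 BON; have tot := bword_total F B0 Btot.
exists (bword B); split=> // [u|q i j]; first exact: bword_fock.
have gW b w u := @glue_bword _ _ _ _ _ B q i j b w u.
have gI := @glue_inj _ _ _ _ _ B q i j.
have [U UE] := block_shift ON tot gW gI.
have [Phi [PhiE PhiB]] := block_map ON tot gW gI
  (@splitting_bword _ _ _ _ _ B q j) (@splitting_inj _ _ _ _ _ q j) UE.
exists Phi; split=> // [c x y|w u Ww Wu].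
  apply: (bop_ext tot) => u Wu.
  by rewrite bop_addE bop_scaleE !PhiE// -bopZ -bopD.
rewrite PhiE// word_op_tensor//; last first.
  exact: (bword_fock B0 (splitting_bword q j Wu)).
rewrite bop_sum; apply: eq_bigr => r _; rewrite bopD /=.
have Bs : all (bletter B) (drop (j + q) u).
  by case/andP: Wu => _ /allP Bu; apply/allP => b /mem_drop /Bu.
have st : (size (take (j + q) u) <= j + q)%N by rewrite size_take; case: ltnP.
have sd : (size (drop (j + q) u) = size u - (j + q))%N by rewrite size_drop.
have aw : alt [seq tag a | a <- take r w ++ drop r w].
  by rewrite cat_take_drop; move: Ww; rewrite alg_wordE => /andP[].
have rw : size (take r w) = r by rewrite size_takel// -ltnS.
have rd : size (drop r w) = (size w - r)%N by rewrite size_drop.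
have := glue_annih_term B0 BON Btot UE aw Bs st.
have := glue_diag_term B0 BON Btot UE (take r w) (drop r w) Bs st.
rewrite cat_take_drop rw rd => /(_ sd) <- /(_ sd) <-.
by [].
Qed.

(** * The radial decomposition *)

Section RadialCount.
Local Open Scope nat_scope.

(** An entry [(e, q, i, j)] stands for the map with parameters [q], [i], [j], taken with the sign
    (-1)^e. A range of [j] is empty where d - 1 or d - 2 is negative. *)
Definition radial_terms (d : nat) : seq (bool * bool * nat * nat) :=
  [seq (false, false, d - j, j) | j <- iota 0 d.+1] ++
  [seq (true, false, d.-1 - j, j) | j <- iota 0 d] ++
  [seq (false, true, d.-1 - j, j) | j <- iota 0 d] ++
  [seq (true, true, d.-2 - j, j) | j <- iota 0 d.-1].

Lemma size_radial_terms d : size (radial_terms d) = maxn (4 * d) 1.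
Proof. rewrite !size_cat !size_map !size_iota; lia. Qed.

Lemma sum_radial_terms (V : pzRingType) d (g : bool -> nat -> nat -> bool) :
  (\sum_(p <- radial_terms d) (-1) ^+ p.1.1.1 * (g p.1.1.2 p.1.2 p.2)%:R)%R =
  ((\sum_(j < d.+1) g false (d - j) j)%:R - (\sum_(j < d) g false (d.-1 - j) j)%:R
  + (\sum_(j < d) g true (d.-1 - j) j)%:R
  - (\sum_(j < d.-1) g true (d.-2 - j) j)%:R)%R :> V.
Proof.
have iota_ord n (f : nat -> V) : (\sum_(j <- iota 0 n) f j = \sum_(j < n) f j)%R.
  by rewrite -(big_mkord xpredT) /index_iota subn0.
rewrite !natr_sum !big_cat !big_map !iota_ord /= -!sumrN !addrA.
by congr (_ + _ + _ + _)%R; apply: eq_bigr => j _; rewrite ?expr0 ?expr1 ?mul1r ?mulN1r.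
Qed.

Lemma sum_pred1 n l (b : bool) : (b -> l < n) ->
  \sum_(j < n) ((j == l :> nat) && b) = b.
Proof.
case: b => [/(_ isT) ln|_]; last by rewrite big1// => j _; rewrite andbF.
rewrite (bigD1 (Ordinal ln))//= eqxx big1 ?addn0// => j.
by rewrite -val_eqE/= => /negbTE->.
Qed.

(** The equation is c + 2j = d + l. At j = l it reads c + l = d; its solutions with j > l become
    those for d - 2 when j is lowered by one. *)
Lemma radial_count_even d c l :
  \sum_(j < d.+1) ((c + j == d - j + l) && (l <= j)) =
  \sum_(j < d.-1) ((c + j == d.-2 - j + l) && (l <= j)) + (c + l == d).
Proof.
case: d => [|d]; first by rewrite big_ord1 big_ord0 /=; lia.
rewrite -[X in _ = _ + X](@sum_pred1 d.+2 l); last by lia.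
transitivity (\sum_(j < d.+2) ((c + j + j == d.+1 + l) && (l < j) +
    ((j == l :> nat) && (c + l == d.+1)))).
  by apply: eq_bigr => -[j jd] _ /=; lia.
rewrite big_split/=; congr (_ + _); rewrite big_ord_recl big_ord_recr /=.
rewrite ltn0 andbF add0n [X in _ + X](_ : _ = 0) ?addn0; last by rewrite /bump /=; lia.
by apply: eq_bigr => -[j jd] _; rewrite /bump /=; lia.
Qed.

(** Again j is lowered by one; the extreme values j = 0 and j = d give no solution because l > 0 and
    c > 0. *)
Lemma radial_count_odd1 d c l : 0 < c -> 0 < l ->
  \sum_(j < d.+1) ((c + j == d - j + l) && (l <= j)) =
  \sum_(j < d.-1) ((c + j == d.-2 - j + l) && (l <= j + 1)).
Proof.
move=> c0 l0; case: d => [|d]; first by rewrite big_ord1 big_ord0 /=; lia.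
rewrite big_ord_recl big_ord_recr /= [X in _ + (_ + X)](_ : _ = 0) ?addn0; last first.
  by rewrite /bump /=; lia.
rewrite [X in X + _](_ : _ = 0) ?add0n; last by lia.
by apply: eq_bigr => -[j jd] _; rewrite /bump /=; lia.
Qed.

(** The weaker condition l <= j + 1 admits just one more value, j = l - 1, where the equation
    becomes c + l = d + 1. *)
Lemma radial_count_odd2 d c l : 0 < c -> 0 < l ->
  \sum_(j < d) ((c + j == d.-1 - j + l) && (l <= j + 1)) =
  \sum_(j < d) ((c + j == d.-1 - j + l) && (l <= j)) + (c + l == d.+1).
Proof.
move=> c0 l0; rewrite -[X in _ = _ + X](@sum_pred1 d l.-1); last by lia.
rewrite -big_split/=; apply: eq_bigr => -[j jd] _ /=; lia.
Qed.

(** The condition does not involve the variant, so the two sums with i + j = d - 1 cancel. *)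
Lemma radial_sum_even (V : pzRingType) d c l :
  (\sum_(p <- radial_terms d) (-1) ^+ p.1.1.1 *
    ((c + p.2 == p.1.2 + l) && (l <= p.2))%N%:R)%R = ((c + l == d)%N%:R)%R :> V.
Proof.
rewrite (sum_radial_terms _ _ (fun _ i j => (c + j == i + l) && (l <= j))) subrK.
by rewrite radial_count_even natrD addrC addKr.
Qed.

(** A diagonal letter is counted in both [c] and [l], hence d + 1 on the right. *)
Lemma radial_sum_odd (V : pzRingType) d c l : 0 < c -> 0 < l ->
  (\sum_(p <- radial_terms d) (-1) ^+ p.1.1.1 *
    ((c + p.2 == p.1.2 + l) && (l <= p.2 + p.1.1.2))%N%:R)%R =
  ((c + l == d.+1)%N%:R)%R :> V.
Proof.
move=> c0 l0.
pose g (q : bool) i j := (c + j == i + l) && (l <= if q then j + 1 else j).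
rewrite (eq_bigr (fun p : (bool * bool * nat * nat)%type =>
    (-1) ^+ p.1.1.1 * (g p.1.1.2 p.1.2 p.2)%:R)%R); last first.
  by move=> [[[e []] i] j] _ //=; rewrite addn0.
rewrite sum_radial_terms /g radial_count_odd2// natrD addrA subrK.
by rewrite radial_count_odd1// addrAC subrr add0r.
Qed.

End RadialCount.

(** * Norms of sums and of operator matrices *)

Lemma sqr_sum_le (R : realType) (T : Type) (s : seq T) (a : T -> R) :
  (\sum_(p <- s) a p) ^+ 2 <= (size s)%:R * \sum_(p <- s) a p ^+ 2.
Proof.
elim: s => [|p s IHs]; first by rewrite !big_nil expr0n mul0r.
rewrite !big_cons /= -natr1; move: IHs.
set S := \sum_(_ <- _) _; set Q := \sum_(_ <- _) _; set n := (size s)%:R => IHs.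
have [s0|s0] := posnP (size s).
  move: IHs; rewrite /n /S /Q (size0nil s0) !big_nil => _.
  by rewrite addr0 add0r mul1r addr0.
have n0 : 0 < n by rewrite ltr0n.
(* After multiplication by [n], the induction hypothesis bounds this from below by the square of
   [n * a p - S]. *)
suff : 0 <= n * ((n + 1) * (a p ^+ 2 + Q) - (a p + S) ^+ 2).
  by rewrite pmulr_rge0// subr_ge0.
have := sqr_ge0 (n * a p - S); nra.
Qed.

(** By homogeneity: a nonzero [x] is scaled to the unit sphere. *)
Lemma mx_opnorm_amplified (R : realType) (H : hilbertType R) n
    (T : 'M['B(H, H)]_n) : (mx_opnorm T <= 1)%E -> amplified_bound T 1.
Proof.
move=> T1 x; rewrite mul1r; set S := \sum_j sqn (x j).
have S0 : 0 <= S by apply: sumr_ge0 => j _; exact: sqn_ge0.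
have [Sz|Sn] := eqVneq S 0.
  have x0 j : x j = 0.
    apply: sqn_eq0; apply/eqP; move: Sz => /eqP.
    rewrite psumr_eq0 => [/allP/(_ j)|i _]; last exact: sqn_ge0.
    by rewrite mem_index_enum => /(_ isT).
  rewrite Sz big1// => i _; rewrite big1 ?sqn0// => j _.
  by rewrite x0 bop0.
pose r : R := (Num.sqrt S)^-1.
have Sp : 0 < S by rewrite lt_neqAle eq_sym Sn.
have r2 : r ^+ 2 * S = 1 by rewrite /r exprVn sqr_sqrtr// mulVf.
have rE : complex.Re `|r%:C%C| = r.
  by rewrite ger0_norm// lecR invr_ge0 sqrtr_ge0.
have : ((Num.sqrt (\sum_i sqn (\sum_j T i j (r%:C%C *: x j))))%:E <= 1)%E.
  apply: le_trans T1; apply: ereal_sup_ubound; exists (fun j => r%:C%C *: x j) => //=.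
  under eq_bigr do rewrite -/(sqn _) sqnZ rE.
  by rewrite -mulr_sumr r2.
have -> : \sum_i sqn (\sum_j T i j (r%:C%C *: x j)) =
    r ^+ 2 * \sum_i sqn (\sum_j T i j (x j)).
  rewrite mulr_sumr; apply: eq_bigr => i _; rewrite -[in RHS]rE -sqnZ scaler_sumr.
  by congr sqn; apply: eq_bigr => j _; rewrite bopZ.
rewrite lee_fin -[X in _ <= X]sqrtr1 ler_sqrt// -r2 ler_pM2l//.
by rewrite exprn_gt0// invr_gt0 sqrtr_gt0.
Qed.

Lemma amplified_mx_opnorm (R : realType) (H : hilbertType R) n
    (T : 'M['B(H, H)]_n) (K : R) : 0 <= K -> amplified_bound T (K ^+ 2) ->
  (mx_opnorm T <= K%:E)%E.
Proof.
move=> K0 TK; apply: ge_ereal_sup => _ [x /= x1 <-]; rewrite lee_fin.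
rewrite -[X in _ <= X](ger0_norm K0) -sqrtr_sqr; apply: ler_wsqrtr.
apply: le_trans (TK x) _; rewrite ler_piMr// sqr_ge0//.
Qed.

Lemma sqn_sum_le (R : realType) (H : hilbertType R) (T : Type) (s : seq T) (f : T -> H) :
  sqn (\sum_(p <- s) f p) <= (size s)%:R * \sum_(p <- s) sqn (f p).
Proof.
apply: le_trans (sqr_sum_le _ _); rewrite ler_sqr ?nnegrE ?rnorm_ge0 ?rnorm_sum//.
by apply: sumr_ge0 => p _; exact: rnorm_ge0.
Qed.

Lemma bop_sumE (R : realType) (H K : hilbertType R) (T : Type) (s : seq T)
    (f : T -> 'B(H, K)) x : (\sum_(p <- s) f p) x = \sum_(p <- s) f p x.
Proof. by apply: (big_morph (fun S : 'B(H, K) => S x)). Qed.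

Theorem corollary3p3 (R : realType) (I : eqType) (A : I -> cstarAlgType R)
    (phi : forall i, state (A i)) (G : forall i, gns (phi i))
    (G_faithful : forall i, injective (gns_rep (G i)))
    (F : fock G) (lam : free_rep F) (d : nat) :
  exists E : 'B(F, F) -> 'B(F, F),
    [/\ linear_on (reduced_free_product lam) E,
        forall T, reduced_free_product lam T -> homogeneous_part lam d (E T),
        forall S T, is_component lam d S T -> E S = T
      & (cb_norm (reduced_free_product lam) E <= (maxn (4 * d) 1)%:R%:E)%E].
Proof.
have [W [tot Wfock Phi_ex]] := compression_exists lam.
pose Phi (p : bool * bool * nat * nat) :=
  projT1 (cid (Phi_ex p.1.1.2 p.1.2 p.2)).
have PhiP (p : bool * bool * nat * nat) := projT2 (cid (Phi_ex p.1.1.2 p.1.2 p.2)).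
pose sg (p : bool * bool * nat * nat) : R[i] := (-1) ^+ p.1.1.1.
pose E (T : 'B(F, F)) : 'B(F, F) := \sum_(p <- radial_terms d) sg p *: Phi p T.
pose K : R := (maxn (4 * d) 1)%:R.
have K0 : 0 < K by rewrite ltr0n leq_maxr.
have E_lin : linear E.
  move=> c S T; rewrite /E scaler_sumr -big_split/=; apply: eq_bigr => p _.
  have [_ lin _] := PhiP p.
  by rewrite /Phi lin scalerDr !scalerA mulrC.
(* One factor [K], the number of terms, comes from the squared norm of a sum of [K] vectors, the
   other from adding up the bounds of [K] complete contractions. *)
have E_bound n (T : 'M['B(F, F)]_n) c :
    amplified_bound T c -> amplified_bound (map_mx E T) (K ^+ 2 * c).
  move=> Tc x.
  have le_i i : sqn (\sum_j map_mx E T i j (x j)) <=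
      K * \sum_(p <- radial_terms d) sqn (\sum_j map_mx (Phi p) T i j (x j)).
    rewrite [in leLHS](_ : \sum_j _ =
        \sum_(p <- radial_terms d) sg p *: \sum_j map_mx (Phi p) T i j (x j)); last first.
      under [RHS]eq_bigr do rewrite scaler_sumr.
      rewrite exchange_big/=; apply: eq_bigr => j _; rewrite mxE bop_sumE.
      by apply: eq_bigr => p _; rewrite mxE bop_scaleE.
    rewrite /K -size_radial_terms; apply: le_trans (sqn_sum_le _ _) _.
    rewrite le_eqVlt; apply/orP; left; apply/eqP; congr (_ * _).
    apply: eq_bigr => p _; rewrite sqnZ /sg normrX normrN1 expr1n.
    by rewrite [complex.Re 1]/(1 : R) expr1n mul1r.
  apply: (@le_trans _ _ (\sum_i K *
      \sum_(p <- radial_terms d) sqn (\sum_j map_mx (Phi p) T i j (x j)))).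
    exact: ler_sum.
  rewrite -mulr_sumr exchange_big/= expr2 -!mulrA ler_pM2l//.
  apply: (@le_trans _ _ (\sum_(p <- radial_terms d) c * \sum_j sqn (x j))).
    by apply: ler_sum => p _; have [B _ _] := PhiP p; exact: B.
  by rewrite big_const_seq count_predT size_radial_terms iter_addr_0 -mulr_natl.
(* Exchanging the sums over the maps and over the cuts leaves at each cut a signed count over
   [radial_terms], which is 1 if [size w = d] and 0 otherwise. *)
have E_word w : alg_word phi w -> E (word_op lam w) = (size w == d)%:R *: word_op lam w.
  move=> Ww; apply: (bop_ext tot) => u Wu.
  rewrite bop_scaleE bop_sumE word_op_tensor ?Wfock//.
  have -> : \sum_(p <- radial_terms d) (sg p *: Phi p (word_op lam w)) (fock_tensor F u) =
      \sum_(p <- radial_terms d) \sum_(r < (size w).+1)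
        ((sg p * ((r + p.2 == p.1.2 + (size w - r)) && (size w - r <= p.2))%N%:R) *:
           annih_term F (take r w) (drop r w) u +
         (sg p * ((r.+1 + p.2 == p.1.2 + (size w - r)) &&
                  (size w - r <= p.2 + p.1.1.2))%N%:R) *:
           diag_term F (take r w) (drop r w) u).
    apply: eq_bigr => p _; have [_ _ PE] := PhiP p.
    rewrite bop_scaleE /Phi PE// scaler_sumr; apply: eq_bigr => r _.
    by rewrite scalerDr !scalerA.
  rewrite exchange_big/= scaler_sumr; apply: eq_bigr => -[r /= rw] _.
  rewrite big_split/= -!scaler_suml scalerDr radial_sum_even subnKC//.
  (* The cut behind the whole word leaves no letter to act diagonally; it is treated apart because
     the count needs l > 0. *)
  congr (_ + _); have [rs|rs] := ltnP r (size w); last first.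
    by rewrite (drop_oversize rs) !scaler0.
  by rewrite radial_sum_odd ?subn_gt0// addSn subnKC.
have E0 : E 0 = 0 by have := E_lin (-1) 0 0; rewrite scaler0 addr0 scaleN1r addNr.
have E_Sigma k S : Sigma lam k S -> E S = (k == d)%:R *: S.
  move: S; apply: lspan_min => [_ [w [Ww <-] <-]||c S T SE TE]; first exact: E_word.
    by rewrite E0 scaler0.
  by rewrite E_lin SE TE scalerDr !scalerA mulrC.
have E_sum n (x : nat -> 'B(F, F)) : (forall k, Sigma lam k (x k)) ->
    E (\sum_(k < n) x k) = \sum_(k < n) (k == d :> nat)%:R *: x k.
  move=> xS; elim: n => [|n IHn]; first by rewrite !big_ord0.
  rewrite !big_ord_recr/= -(E_Sigma _ _ (xS n)) -IHn.
  by have := E_lin 1 (\sum_(k < n) x k) (x n); rewrite !scale1r.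
have E_norm T : opnorm (E T) <= K * opnorm T.
  apply: opnorm_leP; first by rewrite mulr_ge0 ?opnorm_ge0// ltW.
  move=> x; rewrite -ler_sqr ?nnegrE ?mulr_ge0 ?opnorm_ge0 ?rnorm_ge0 ?(ltW K0)//.
  have := E_bound _ _ _ (amplified_bound_opnorm T) (fun=> x).
  by rewrite !big_ord1 !mxE !exprMn.
exists E; split.
- by move=> c u v _ _; exact: E_lin.
(* [E] maps the algebraic free product into [Sigma lam d] and is bounded, so it maps the closure
   into the closure. *)
- move=> T /bop_closureP AT; apply/bop_closureP => e e0.
  have [_ [n [x [xS ->]]] Te] := AT _ (divr_gt0 e0 K0).
  exists (E (\sum_(k < n) x k)).
    rewrite E_sum//; apply: lspan_sum => k _.
    case: eqP => [kd|_]; first by rewrite -kd; apply: lspanZ; exact: xS.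
    by rewrite scale0r; exact: lspan0.
  have -> : E T - E (\sum_(k < n) x k) = E (T - \sum_(k < n) x k).
    by rewrite addrC -scaleN1r -E_lin scaleN1r addrC.
  apply: le_lt_trans (E_norm _) _; by rewrite mulrC -ltr_pdivlMr.
- move=> S T [n [x [dn xS -> ->]]]; rewrite E_sum//.
  rewrite (bigD1 (Ordinal dn))//= eqxx scale1r big1 ?addr0// => k.
  by rewrite -val_eqE/= => /negbTE->; rewrite scale0r.
- apply: ge_ereal_sup => _ [n [T [_ T1 ->]]].
  apply: amplified_mx_opnorm; first exact: ltW.
  by have := E_bound _ _ _ (mx_opnorm_amplified T1); rewrite mulr1.
Qed.
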